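(* Let $\Delta t>0$, $\beta_1=\beta_3=(2+2^{1/3}+2^{-1/3})/3$ and $\beta_2=1-2\beta_1$ (so that $\beta_1+\beta_2+\beta_3=1$ and $\beta_1^3+\beta_2^3+\beta_3^3=1$). Define $$\text{Scheme-4F}(\Delta t)=\text{Scheme-4}(\beta_1\Delta t)\,\text{Scheme-4}(\beta_2\Delta t)\,\text{Scheme-4}(\beta_3\Delta t),$$ $$\text{Scheme-5F}(\Delta t)=\text{Scheme-5}(\beta_1\Delta t)\,\text{Scheme-5}(\beta_2\Delta t)\,\text{Scheme-5}(\beta_3\Delta t),$$ where Scheme-4 and Scheme-5 are the one-step maps described in the context. If $(f^{n+1},\mathbf{E}^{n+1},\mathbf{B}^{n+1})$ is obtained from $(f^n,\mathbf{E}^n,\mathbf{B}^n)$ by Scheme-4F$(\Delta t)$ or by Scheme-5F$(\Delta t)$, then $TE_n=TE_{n+1}$, where $$2\,TE_n=\int_{\Omega_x}\int_{\Omega_v} f^n|\mathbf{v}|^2\,d\mathbf{v}\,d\mathbf{x}+\int_{\Omega_x}\big(|\mathbf{E}^n|^2+|\mathbf{B}^n|^2\big)\,d\mathbf{x}.$$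
   Context: Setting. $\Omega_x\subset\mathbb{R}^3$ is a box with periodic boundary conditions and $\Omega_v\subset\mathbb{R}^3$ is a bounded velocity domain. The unknowns are $f=f(\mathbf{x},\mathbf{v})$ on $\Omega_x\times\Omega_v$ (scalar) and $\mathbf{E}(\mathbf{x}),\mathbf{B}(\mathbf{x})\in\mathbb{R}^3$ on $\Omega_x$. All functions are smooth enough for the expressions below to make sense, periodic in $\mathbf{x}$, and all $f$'s (including those at intermediate substeps) vanish on $\partial\Omega_v$. For any time index $s$, $\mathbf{J}^s(\mathbf{x})=\int_{\Omega_v}f^s(\mathbf{x},\mathbf{v})\,\mathbf{v}\,d\mathbf{v}$. Each of the following maps a state $(f^n,\mathbf{E}^n,\mathbf{B}^n)$ to a state $(f^{n+1},\mathbf{E}^{n+1},\mathbf{B}^{n+1})$ (here $n,n+1$ label the beginning and end of the (sub)step, and for the implicit equations the new state is any solution), with step size $\tau\neq0$, possibly negative. Scheme-4$(\tau)$: $\frac{\mathbf{B}^{n+1}-\mathbf{B}^n}{\tau}=-\nabla_{\mathbf{x}}\times\frac{\mathbf{E}^n+\mathbf{E}^{n+1}}{2}$; $\frac{\mathbf{E}^{n+1}-\mathbf{E}^n}{\tau}=\nabla_{\mathbf{x}}\times\frac{\mathbf{B}^n+\mathbf{B}^{n+1}}{2}-\frac{\mathbf{J}^n+\mathbf{J}^{n+1}}{2}$; $\frac{f^{n+1}-f^n}{\tau}+\mathbf{v}\cdot\nabla_{\mathbf{x}}\frac{f^n+f^{n+1}}{2}+\big(\tfrac12(\mathbf{E}^n+\mathbf{E}^{n+1})+\tfrac12\mathbf{v}\times(\mathbf{B}^n+\mathbf{B}^{n+1})\big)\cdot\nabla_{\mathbf{v}}\frac{f^n+f^{n+1}}{2}=0$.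 Scheme-5$(\tau)=$ Scheme-a$(\tau/2)$ Scheme-b$(\tau/2)$ Scheme-c$(\tau)$ Scheme-b$(\tau/2)$ Scheme-a$(\tau/2)$, where Scheme-a$(\tau)$: $\frac{f^{n+1}-f^n}{\tau}+\mathbf{v}\cdot\nabla_{\mathbf{x}}\frac{f^n+f^{n+1}}{2}=0$, $\mathbf{E}^{n+1}=\mathbf{E}^n$, $\mathbf{B}^{n+1}=\mathbf{B}^n$. Scheme-b$(\tau)$: $\frac{f^{n+1}-f^n}{\tau}+\tfrac12(\mathbf{E}^n+\mathbf{E}^{n+1})\cdot\nabla_{\mathbf{v}}\frac{f^n+f^{n+1}}{2}=0$, $\frac{\mathbf{E}^{n+1}-\mathbf{E}^n}{\tau}=-\tfrac12(\mathbf{J}^n+\mathbf{J}^{n+1})$, $\mathbf{B}^{n+1}=\mathbf{B}^n$. Scheme-c$(\tau)$: $\frac{\mathbf{B}^{n+1}-\mathbf{B}^n}{\tau}=-\nabla_{\mathbf{x}}\times\frac{\mathbf{E}^n+\mathbf{E}^{n+1}}{2}$, $\frac{\mathbf{E}^{n+1}-\mathbf{E}^n}{\tau}=\nabla_{\mathbf{x}}\times\frac{\mathbf{B}^n+\mathbf{B}^{n+1}}{2}$, $\frac{f^{n+1}-f^n}{\tau}+\tfrac12\big(\mathbf{v}\times(\mathbf{B}^n+\mathbf{B}^{n+1})\big)\cdot\nabla_{\mathbf{v}}\frac{f^n+f^{n+1}}{2}=0$. Juxtaposition of schemes denotes composition of the maps.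
   Formalization: The parenthetical claim that the cubes of the betas sum to 1 is false: for the stated values the sum of cubes is 0. The formal theorem keeps the explicit betas and drops this claim; energy conservation itself is unaffected. *)

(* Defs.v *)
From HB Require Import structures.
From mathcomp Require Import all_boot all_order all_algebra.
From mathcomp Require Import all_classical all_reals all_analysis.
From mathcomp Require Import ring.

Set Implicit Arguments.
Unset Strict Implicit.
Unset Printing Implicit Defensive.

Import Order.TTheory GRing.Theory Num.Theory.
Import numFieldNormedType.Exports.

Local Open Scope classical_set_scope.
Local Open Scope ring_scope.

Lemma sigma_finite_product d1 d2 (T1 : measurableType d1)
    (T2 : measurableType d2) (R : realType)
    (m1 : {sigma_finite_measure set T1 -> \bar R})
    (m2 : {sigma_finite_measure set T2 -> \bar R}) :
  sigma_finite setT (m1 \x m2)%E.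
Proof.
have /sigma_finiteP[F [TF ndF Foo]] := sigma_finiteT m1.
have /sigma_finiteP[G [TG ndG Goo]] := sigma_finiteT m2.
exists (fun n => F n `*` G n).
  rewrite -setXTT TF TG predeqE => -[x y]; split.
    move=> [/= [n _ Fnx] [k _ Gky]]; exists (maxn n k) => //; split.
    - by move: x Fnx; exact/subsetPset/ndF/leq_maxl.
    - by move: y Gky; exact/subsetPset/ndG/leq_maxr.
  by move=> [n _ []/= ? ?]; split; exists n.
move=> k; have [? ?] := Foo k; have [? ?] := Goo k.
split; first exact: measurableX.
by rewrite product_measure1E// lte_mul_pinfty// ge0_fin_numE.
Qed.

Notation vec3 R := (R * R * R)%type.

Section Vec3.
Context {R : realType}.
Implicit Types (u w p : vec3 R) (g : vec3 R -> R) (F : vec3 R -> vec3 R).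

Definition vx u : R := u.1.1.
Definition vy u : R := u.1.2.
Definition vz u : R := u.2.

Definition ex : vec3 R := (1, 0, 0).
Definition ey : vec3 R := (0, 1, 0).
Definition ez : vec3 R := (0, 0, 1).

(* The library norm of a product space is the maximum norm; the Euclidean
   |u|^2 is [dot u u]. *)
Definition dot u w : R := vx u * vx w + vy u * vy w + vz u * vz w.

Definition cross u w : vec3 R :=
  (vy u * vz w - vz u * vy w,
   vz u * vx w - vx u * vz w,
   vx u * vy w - vy u * vx w).

Definition grad g p : vec3 R := ('D_ex g p, 'D_ey g p, 'D_ez g p).

Definition curl F p : vec3 R :=
  ('D_ey (vz \o F) p - 'D_ez (vy \o F) p,
   'D_ez (vx \o F) p - 'D_ex (vz \o F) p,
   'D_ex (vy \o F) p - 'D_ey (vx \o F) p).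

(* Lebesgue measure on R^3.  The auxiliary constant [leb2] and the explicit
   sigma-finiteness instances are there because the library does not infer that
   structure on a product of two measures that are merely sigma-finite. *)
Definition leb2 :
    set (measurableTypeR R * measurableTypeR R)%type -> \bar R :=
  (@lebesgue_measure R \x @lebesgue_measure R)%E.
HB.instance Definition _ := Measure.on leb2.
HB.instance Definition _ := Measure_isSigmaFinite.Build _ _ _ leb2
  (sigma_finite_product (@lebesgue_measure R) (@lebesgue_measure R)).

Definition leb3 :
    set (measurableTypeR R * measurableTypeR R * measurableTypeR R)%type ->
    \bar R := (leb2 \x @lebesgue_measure R)%E.
HB.instance Definition _ := Measure.on leb3.
HB.instance Definition _ := Measure_isSigmaFinite.Build _ _ _ leb3
  (sigma_finite_product leb2 (@lebesgue_measure R)).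

Definition box (a b : vec3 R) : set (vec3 R) :=
  [set p | [/\ vx a <= vx p <= vx b, vy a <= vy p <= vy b
             & vz a <= vz p <= vz b]].

Definition periodic (W : Type) (a b : vec3 R) (h : vec3 R -> W) : Prop :=
  forall p, [/\ h (p + (vx b - vx a) *: ex) = h p,
                h (p + (vy b - vy a) *: ey) = h p
              & h (p + (vz b - vz a) *: ez) = h p].

Definition bdry (U : set (vec3 R)) : set (vec3 R) := closure U `\` interior U.

End Vec3.

Definition C1_on (R : realType) (V W : normedModType R) (U : set V)
    (h : V -> W) : Prop :=
  (forall p, U p -> differentiable h p) /\
  (forall e p, U p -> {for p, continuous (fun q => 'D_e h q)}).

(* Densities f(x, v) on [box a b] x Ov, carried by their periodic extension in
   x; values at v outside the closure of Ov are irrelevant.  The integrability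
   clause holds in particular when the first derivatives of f are bounded, so
   whenever f is C^1 up to the boundary of Ov. *)
Record smooth_density (R : realType) (a b : vec3 R) (Ov : set (vec3 R))
    (f : vec3 R -> vec3 R -> R) : Prop := SmoothDensity {
  density_continuous :
    {within [set: vec3 R] `*` closure Ov,
      continuous (fun p : vec3 R * vec3 R => f p.1 p.2)} ;
  density_C1 :
    C1_on ([set: vec3 R] `*` Ov) (fun p : vec3 R * vec3 R => f p.1 p.2) ;
  density_integrable : forall e : vec3 R * vec3 R,
    (leb3 \x leb3)%E.-integrable (box a b `*` Ov)
      (fun q => ('D_e (fun p : vec3 R * vec3 R => f p.1 p.2) q)%:E)
}.

(* The states (f, E, B) among which each scheme looks for its solution; in a
   composition of schemes all intermediate states are of this type too. *)
Record state (R : realType) (a b : vec3 R) (Ov : set (vec3 R)) := State {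
  dens : vec3 R -> vec3 R -> R ;
  elec : vec3 R -> vec3 R ;
  magn : vec3 R -> vec3 R ;
  dens_smooth : smooth_density a b Ov dens ;
  dens_periodic : forall v, closure Ov v -> periodic a b (fun x => dens x v) ;
  dens_bdry : forall x v, bdry Ov v -> dens x v = 0 ;
  elec_C1 : C1_on [set: vec3 R] elec ;
  elec_periodic : periodic a b elec ;
  magn_C1 : C1_on [set: vec3 R] magn ;
  magn_periodic : periodic a b magn
}.

Section Schemes.
Context {R : realType} {a b : vec3 R} {Ov : set (vec3 R)}.
Implicit Types (s : state a b Ov) (t : R).

Definition current s (x : vec3 R) : vec3 R :=
  (\int[leb3]_(v in Ov) (dens s x v * vx v),
   \int[leb3]_(v in Ov) (dens s x v * vy v),
   \int[leb3]_(v in Ov) (dens s x v * vz v)).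

Definition total_energy s : R :=
  2^-1 * (\int[leb3]_(x in box a b)
            (\int[leb3]_(v in Ov) (dens s x v * dot v v))
          + \int[leb3]_(x in box a b)
            (dot (elec s x) (elec s x) + dot (magn s x) (magn s x))).

Definition avg_elec s s' (x : vec3 R) : vec3 R :=
  2^-1 *: (elec s x + elec s' x).
Definition avg_magn s s' (x : vec3 R) : vec3 R :=
  2^-1 *: (magn s x + magn s' x).
Definition avg_current s s' (x : vec3 R) : vec3 R :=
  2^-1 *: (current s x + current s' x).
Definition avg_dens s s' (x v : vec3 R) : R :=
  (dens s x v + dens s' x v) / 2.

(* One-step maps are relations: [S s s'] says that s' is a solution of the
   (implicit) equations of S started at s. *)
Definition scheme := state a b Ov -> state a b Ov -> Prop.

(* As for maps, the right-hand factor acts first. *)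
Definition scheme_comp (S1 S2 : scheme) : scheme :=
  fun s s' => exists2 m, S2 s m & S1 m s'.

Local Notation "S1 \oS S2" := (scheme_comp S1 S2)
  (at level 50, left associativity).

Definition scheme4 t : scheme := fun s s' =>
  [/\ forall x, t^-1 *: (magn s' x - magn s x) = - curl (avg_elec s s') x,
      forall x, t^-1 *: (elec s' x - elec s x) =
                curl (avg_magn s s') x - avg_current s s' x
    & forall x v, Ov v ->
        (dens s' x v - dens s x v) / t
        + dot v (grad (fun y => avg_dens s s' y v) x)
        + dot (avg_elec s s' x + cross v (avg_magn s s' x))
              (grad (avg_dens s s' x) v) = 0].

Definition scheme_a t : scheme := fun s s' =>
  [/\ forall x v, Ov v ->
        (dens s' x v - dens s x v) / t
        + dot v (grad (fun y => avg_dens s s' y v) x) = 0,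
      forall x, elec s' x = elec s x
    & forall x, magn s' x = magn s x].

Definition scheme_b t : scheme := fun s s' =>
  [/\ forall x v, Ov v ->
        (dens s' x v - dens s x v) / t
        + dot (avg_elec s s' x) (grad (avg_dens s s' x) v) = 0,
      forall x, t^-1 *: (elec s' x - elec s x) = - avg_current s s' x
    & forall x, magn s' x = magn s x].

Definition scheme_c t : scheme := fun s s' =>
  [/\ forall x, t^-1 *: (magn s' x - magn s x) = - curl (avg_elec s s') x,
      forall x, t^-1 *: (elec s' x - elec s x) = curl (avg_magn s s') x
    & forall x v, Ov v ->
        (dens s' x v - dens s x v) / t
        + dot (cross v (avg_magn s s' x)) (grad (avg_dens s s' x) v) = 0].

Definition scheme5 t : scheme :=
  scheme_a (t / 2) \oS scheme_b (t / 2) \oS scheme_c t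
  \oS scheme_b (t / 2) \oS scheme_a (t / 2).

Definition beta1 : R := (2 + 2 `^ (3^-1) + 2 `^ (- 3^-1)) / 3.
Definition beta2 : R := 1 - 2 * beta1.
Definition beta3 : R := beta1.

Definition scheme4F t : scheme :=
  scheme4 (beta1 * t) \oS scheme4 (beta2 * t) \oS scheme4 (beta3 * t).

Definition scheme5F t : scheme :=
  scheme5 (beta1 * t) \oS scheme5 (beta2 * t) \oS scheme5 (beta3 * t).

End Schemes.

Lemma beta_sum (R : realType) : beta1 + beta2 + beta3 = 1 :> R.
Proof. by rewrite /beta3 /beta2; ring. Qed.

(* The order condition satisfied by these coefficients has right-hand side 0:
   if beta3 = beta1 and beta2 = 1 - 2 beta1, the sum of cubes is
   1 - 6 beta1 (1 - beta1)^2, which is 1 only for beta1 = 0 or 1. *)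
Lemma beta_cube_sum (R : realType) :
  beta1 ^+ 3 + beta2 ^+ 3 + beta3 ^+ 3 = 0 :> R.
Proof.
rewrite /beta3 /beta2 /beta1 powRN.
set c := 2 `^ 3^-1.
have c3 : c ^+ 3 = 2.
  by rewrite /c -powR_mulrn ?powR_ge0// -powRrM mulVf ?powRr1.
have c0 : c != 0.
  by apply/eqP => c0; move: c3; rewrite c0 expr0n /= => /esym/eqP; rewrite pnatr_eq0.
have -> : c^-1 = c ^+ 2 / 2.
  by apply: (mulfI c0); rewrite divff// mulrA -exprS c3 divff// pnatr_eq0.
set x := (_ / 3).
have -> : x ^+ 3 + (1 - 2 * x) ^+ 3 + x ^+ 3 =
  - (c ^+ 3 - 2) * (c ^+ 3 + 6 * c ^+ 2 + 12 * c + 10) / 36.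
  by rewrite /x; field.
by rewrite c3 subrr oppr0 !mul0r.
Qed.

(* Main.v *)
(** Every substep is an implicit midpoint step in which the free transport, the
electric terms and the magnetic terms carry constant factors [al], [ga] and [de]
equal to 0 or 1.  Multiply its Vlasov equation by |v|^2 and integrate.  The
transport term vanishes by periodicity; since the i-th component of v x B does
not depend on v_i, integration by parts in v turns
|v|^2 (ga E + de v x B) . grad_v f into -2 ga (v . E) f.  Hence the kinetic
energy changes by the work of the averaged field on the averaged current.
Pairing the Maxwell equations with the averaged fields shows that the field
energy changes by the opposite amount, because the Poynting flux integrates to
zero over a period.

The v-derivatives of f are merely integrable on [box a b `*` Ov], and [Ov] is an
arbitrary bounded open set.  Integration by parts is therefore performed on
almost every line (Fubini): a line meets [Ov] in countably many disjoint open
intervals, f vanishes at their endpoints, and the fundamental theorem of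
calculus holds on each of them with an integrable derivative. *)
Require Import Defs.
From mathcomp Require Import all_boot all_order all_algebra.
From mathcomp Require Import all_classical all_reals all_analysis.
From mathcomp Require Import measurable_realfun ring lra.

Import Order.TTheory GRing.Theory Num.Theory.
Import numFieldNormedType.Exports.

Set Implicit Arguments.
Unset Strict Implicit.
Unset Printing Implicit Defensive.

Local Open Scope classical_set_scope.
Local Open Scope ring_scope.

(** * The fundamental theorem of calculus on bounded open sets of the line *)

(** The indefinite integral [H] of [g] also has derivative [g] inside the interval, so the mean
    value theorem gives [H - G] equal values at [a] and [b]. Integrability stands in for continuity
    of [g] at the endpoints. *)
Lemma Rintegral_derive_itv (R : realType) (G g : R -> R) (a b : R) :
  a < b -> {within `[a, b], continuous G} ->
  (forall x, x \in `]a, b[ -> is_derive x 1 G (g x)) ->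
  (forall x, x \in `]a, b[ -> {for x, continuous g}) ->
  lebesgue_measure.-integrable `[a, b] (EFin \o g) ->
  \int[lebesgue_measure]_(x in `[a, b]) g x = G b - G a.
Proof.
move=> ab cG dG cg ig.
pose H x := \int[lebesgue_measure]_(t in `[a, x]) g t.
have cH : {within `[a, b], continuous H}.
  exact: (parameterized_integral_continuous (ltW ab) ig).
have dH x : x \in `]a, b[ -> is_derive x 1 H (g x).
  move=> xab; have /andP[ax xb] : a < x < b by rewrite in_itv/= in xab.
  have [d1 d2] := continuous_FTC1_closed xb ig ax (cg x xab).
  by rewrite derive1E in d2; exact: DeriveDef d1 d2.
have [||c cab] := @MVT R (H - G) (fun=> 0) a b ab.
- move=> x xab; have dHx := dH x xab; have dGx := dG x xab.
  by have := is_deriveB dHx dGx; rewrite subrr.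
- by apply: within_continuousB.
rewrite mul0r !fctE /H set_itv1 Rintegral_set1 => /eqP.
by rewrite subr_eq0 sub0r subr_eq => /eqP ->; rewrite addrC.
Qed.

Lemma bounded_open_interval (R : realType) (I : set R) :
  open I -> is_interval I -> bounded_set I -> I !=set0 ->
  exists a b, a < b /\ I = `]a, b[%classic.
Proof.
move=> oI iI bI I0.
have [M [_ HM]] := bI.
(* [bounded_set] gives a bound by every real strictly above [M]; [M + 1] is one of them. *)
have bM x : I x -> `|x| <= M + 1 by move=> Ix; exact: (HM (M + 1) (ltr_pwDr ltr01 (lexx M)) x Ix).
have hl : has_lbound I.
  by exists (- (M + 1)) => x /bM; rewrite ler_norml => /andP[].
have hu : has_ubound I.
  by exists (M + 1) => x /bM; rewrite ler_norml => /andP[].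
have E := interval_bounded_interior iI hl hu.
exists (inf I), (sup I).
move: oI; rewrite openE => oI.
have EI : I = [set r | inf I < r < sup I].
  by rewrite -E; apply/seteqP; split => // x; exact: interior_subset.
split; last by rewrite set_itvoo.
by have [x] := I0; rewrite {1}EI => /andP[]; exact: lt_trans.
Qed.

Lemma integral_derive_open_interval (R : realType) (G g : R -> R) (a b : R) :
  a < b -> {within `[a, b], continuous G} -> G a = 0 -> G b = 0 ->
  (forall x, x \in `]a, b[ -> is_derive x 1 G (g x)) ->
  (forall x, x \in `]a, b[ -> {for x, continuous g}) ->
  lebesgue_measure.-integrable `]a, b[ (EFin \o g) ->
  (\int[lebesgue_measure]_(x in `]a, b[) (g x)%:E = 0)%E.
Proof.
move=> ab cG Ga Gb dG cg ig.
(* Extension by zero yields an integrand on the closed interval that agrees with [g] inside, where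
   continuity is required. *)
pose g' := g \_ `]a, b[.
have oab : open `]a, b[%classic by exact: interval_open.
have g'E x : x \in `]a, b[ -> g' x = g x.
  by move=> xab; rewrite /g' patchE mem_set.
have I' : `[a, b] `&` `]a, b[ = `]a, b[%classic :> set R.
  by apply: setIidr; exact: subset_itv_oo_cc.
have ig' : lebesgue_measure.-integrable `[a, b] (EFin \o g').
  rewrite /g' -restrict_EFin; apply/integrable_restrict => //.
  by rewrite I'.
rewrite -I' integral_mkcondr restrict_EFin.
have -> : (\int[lebesgue_measure]_(x in `[a, b]) (g' x)%:E)%E =
          (\int[lebesgue_measure]_(x in `[a, b]) g' x)%:E.
  by rewrite fineK//; exact: integrable_fin_num.
rewrite -[RHS]/(0%R%:E) -(subrr (0 : R)) -{1}Gb -Ga; congr EFin.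
apply: Rintegral_derive_itv => //.
- by move=> x xab; rewrite g'E//; exact: dG.
- move=> x xab.
  have nx : \forall y \near x, g y = g' y.
    have := open_nbhs_nbhs (conj oab xab); apply: filterS => y yab.
    by rewrite g'E.
  rewrite /prop_for /continuous_at g'E//.
  apply: cvg_trans (cg x xab).
  exact: near_eq_cvg.
Qed.

Lemma itvcc_sub_closure_itvoo (R : realType) (a b : R) : a < b ->
  `[a, b]%classic `<=` closure `]a, b[%classic.
Proof.
move=> ab c /=; rewrite in_itv/= => /andP[ac cb] B /nbhs_ballP[e /= e0 eB].
have ba0 : 0 < b - a by rewrite subr_gt0.
have q0 : 0 < e / (b - a) by rewrite divr_gt0.
pose t := Num.min 1 (e / (b - a)).
have t0 : 0 < t by rewrite lt_min ltr01.
have t1 : t <= 1 by rewrite ge_min lexx.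
have te : t * (b - a) <= e by rewrite -ler_pdivlMr// ge_min lexx orbT.
(* Moves [c] towards the midpoint by the fraction [t]. The new point is interior because [t] is
   positive, and its distance to [c] is at most t (b - a) / 2 < e. *)
exists (c + t * ((a + b) / 2 - c)); split.
- by rewrite /= in_itv/=; apply/andP; split; nra.
- apply: eB; rewrite /ball/= opprD addNKr normrN ltr_norml.
  by apply/andP; split; nra.
Qed.

(* The endpoints of the components of [U] lie outside [U], so [G] vanishes there. *)
Lemma integral_derive_open (R : realType) (U : set R) (G g : R -> R) :
  open U -> bounded_set U ->
  {within closure U, continuous G} -> (forall x, closure U x -> ~ U x -> G x = 0) ->
  (forall x, U x -> is_derive x 1 G (g x)) ->
  (forall x, U x -> {for x, continuous g}) ->
  lebesgue_measure.-integrable U (EFin \o g) ->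
  (\int[lebesgue_measure]_(x in U) (g x)%:E = 0)%E.
Proof.
move=> oU bU cG G0 dG cg ig.
have UI := open_disjoint_itv_bigcup oU.
set I := open_disjoint_itv oU in UI.
have oI i : open (I i) by exact: open_disjoint_itv_open.
have IU i : I i `<=` U by rewrite UI => x Ix; exists i.
have tI : trivIset setT I by exact: open_disjoint_itv_trivIset.
rewrite UI integral_bigcup -?UI//; last by move=> k; exact: open_measurable.
apply: eseries0 => i _ _.
have [->|/set0P I0] := eqVneq (I i) set0; first by rewrite integral_set0.
have [||a [b [ab Iab]]] := @bounded_open_interval R (I i) (oI i) _ _ I0.
- exact: open_disjoint_itv_is_interval.
- have [M [Mr HM]] := bU; exists M; split => // y My x /IU; exact: HM.
have end0 c : c \in `[a, b] -> c \notin `]a, b[ -> G c = 0.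
  move=> cab ncab.
  have clc : closure `]a, b[%classic c.
    exact: itvcc_sub_closure_itvoo.
  apply: G0; first by move: clc; rewrite -Iab; apply: closureS.
  (* If the endpoint [c] were in [U], its component [I j] would be a neighbourhood of [c] and would
     meet [I i]. Disjointness then gives [i = j], but [I i] omits its endpoints. *)
  rewrite UI => -[j _ Ijc].
  have [y [Iy Ijy]] := clc _ (open_nbhs_nbhs (conj (oI j) Ijc)).
  have ij : i = j.
    apply: (tI i j) => //; exists y; split => //; by rewrite Iab.
  by move: Ijc; rewrite -ij Iab => Hc; move/negP: ncab; apply.
rewrite Iab; apply: (@integral_derive_open_interval _ G) => //.
- apply: continuous_subspaceW cG.
  apply: subset_trans (itvcc_sub_closure_itvoo ab) _.
  by rewrite -Iab; exact: closureS.
- by apply: end0; rewrite ?in_itv/= ?lexx ?ltW// ltxx.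
- by apply: end0; rewrite ?in_itv/= ?lexx ?ltW// ltxx andbF.
- by move=> x xab; apply: dG; apply: (IU i); rewrite Iab.
- by move=> x xab; apply: cg; apply: (IU i); rewrite Iab.
- rewrite -Iab; apply: integrableS ig => //; exact: open_measurable.
Qed.

(** * Measurability of open sets and null integrals along lines *)

Notation mR R := (measurableTypeR R).
Notation mvec3 R := (measurableTypeR R * measurableTypeR R * measurableTypeR R)%type.

(* [M] is the sigma-algebra, given as a mere set of sets: the topology and the
   sigma-algebra of R^3 sit on convertible types that no common structure joins. *)
Definition basis_in (T : topologicalType) (M : set (set T)) :=
  exists (I : countType) (B : I -> set T), (forall i, M (B i)) /\
    forall x U, nbhs x U -> exists i, B i x /\ B i `<=` U.

Lemma basis_in_prod (T1 T2 : topologicalType) (M1 : set (set T1))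
    (M2 : set (set T2)) (M : set (set (T1 * T2))) :
  (forall A B, M1 A -> M2 B -> M (A `*` B)) ->
  basis_in M1 -> basis_in M2 -> basis_in M.
Proof.
move=> MX [I1 [B1 [MB1 HB1]]] [I2 [B2 [MB2 HB2]]].
exists (I1 * I2)%type, (fun i => B1 i.1 `*` B2 i.2); split.
  by move=> i; exact: MX.
move=> [x y] U [[/= V W]] [Vx Wy] VWU.
have [i [Bix BiV]] := HB1 _ _ Vx; have [j [Bjy BjW]] := HB2 _ _ Wy.
exists (i, j); split => //= -[z w] [/= Biz Bjw].
by apply: VWU; split => /=; [exact: BiV|exact: BjW].
Qed.

Lemma basis_in_R (R : realType) : @basis_in R (@measurable _ (mR R)).
Proof.
exists (rat * rat)%type, (fun i => `]ratr i.1, ratr i.2[%classic); split.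
  by move=> i; exact: measurable_itv.
move=> x U /nbhs_ballP[e /= e0 eU].
have [q] := @rat_in_itvoo R (x - e) x ltac:(lra).
have [r] := @rat_in_itvoo R x (x + e) ltac:(lra).
rewrite !in_itv/= => /andP[r1 r2] /andP[q1 q2].
exists (q, r) => /=; split; first by rewrite in_itv/= q2.
move=> y/=; rewrite in_itv/= => /andP[qy yr]; apply: eU.
by rewrite /ball/= ltr_norml; apply/andP; split; lra.
Qed.

(** [U] is the union of the basis members that it contains. The union is written as a sequence by
    decoding naturals; a natural that encodes no index, or a member not inside [U], contributes the
    empty set. *)
Lemma basis_in_open (T : topologicalType) (M : set (set T)) (U : set T) :
  M set0 -> (forall F : (set T)^nat, (forall n, M (F n)) -> M (\bigcup_n F n)) ->
  basis_in M -> open U -> M U.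
Proof.
move=> M0 MU [I [B [MB HB]]] oU.
pose F n := if unpickle n is Some i then
  if `[< B i `<=` U >] then B i else set0 else set0.
have -> : U = \bigcup_n F n.
  apply/seteqP; split => [x Ux|x [n _]].
    have [i [Bix BiU]] := HB _ _ (open_nbhs_nbhs (conj oU Ux)).
    by exists (pickle i) => //; rewrite /F pickleK asboolT.
  rewrite /F; case: unpickle => // i.
  by case: asboolP => // + Bix; exact.
apply: MU => n; rewrite /F; case: unpickle => // i.
by case: asboolP.
Qed.

Lemma basis_in_vec3 (R : realType) :
  @basis_in (vec3 R) (@measurable _ (mvec3 R)).
Proof.
apply: (@basis_in_prod _ _ (@measurable _ (mR R * mR R)%type) (@measurable _ (mR R))).
- by move=> A B; exact: measurableX.
- apply: (@basis_in_prod _ _ (@measurable _ (mR R)) (@measurable _ (mR R))).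
  + by move=> A B; exact: measurableX.
  + exact: basis_in_R.
  + exact: basis_in_R.
- exact: basis_in_R.
Qed.

Lemma open_measurable3 (R : realType) (U : set (vec3 R)) :
  open U -> @measurable _ (mvec3 R) U.
Proof.
apply: basis_in_open; first exact: measurable0.
  by move=> F mF; exact: bigcup_measurable.
exact: basis_in_vec3.
Qed.

Lemma open_measurable6 (R : realType) (U : set (vec3 R * vec3 R)) :
  open U -> @measurable _ (mvec3 R * mvec3 R)%type U.
Proof.
apply: basis_in_open; first exact: measurable0.
  by move=> F mF; exact: bigcup_measurable.
apply: (@basis_in_prod _ _ (@measurable _ (mvec3 R)) (@measurable _ (mvec3 R))).
- by move=> A B; exact: measurableX.
- exact: basis_in_vec3.
- exact: basis_in_vec3.
Qed.

Lemma measurable_fun_openP d (T : measurableType d) (R : realType)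
    (D : set T) (f : T -> R) :
  (forall V : set R, open V -> measurable (D `&` f @^-1` V)) ->
  measurable_fun D f.
Proof.
move=> H; apply: (measurability _ (RGenOpens.measurableE R)).
by move=> _ [_ [a [b ->] <-]]; apply: H; exact: interval_open.
Qed.

(** The preimage of an open set is the trace on [D] of an open set of R^3, which the countable basis
    makes measurable for the product sigma-algebra. *)
Lemma within_continuous_measurable3 (R : realType) (D : set (vec3 R))
    (f : vec3 R -> R) :
  @measurable _ (mvec3 R) D -> {within D, continuous f} ->
  @measurable_fun _ _ (mvec3 R) R D f.
Proof.
move=> mD /continuousP cf; apply: measurable_fun_openP => V oV.
have /open_subspaceP[W oW WD] := cf V oV.
rewrite setIC [X in measurable X](_ : _ = W `&` D)//.
by apply: measurableI => //; exact: open_measurable3.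
Qed.

Lemma within_continuous_measurable6 (R : realType) (D : set (vec3 R * vec3 R))
    (f : vec3 R * vec3 R -> R) :
  @measurable _ (mvec3 R * mvec3 R)%type D -> {within D, continuous f} ->
  @measurable_fun _ _ (mvec3 R * mvec3 R)%type R D f.
Proof.
move=> mD /continuousP cf; apply: measurable_fun_openP => V oV.
have /open_subspaceP[W oW WD] := cf V oV.
rewrite setIC [X in measurable X](_ : _ = W `&` D)//.
by apply: measurableI => //; exact: open_measurable6.
Qed.

Section null_slices.
Local Open Scope ereal_scope.
Context d1 d2 (T1 : measurableType d1) (T2 : measurableType d2) (R : realType).
Variables (m1 : {sigma_finite_measure set T1 -> \bar R})
  (m2 : {sigma_finite_measure set T2 -> \bar R}).
Variable f : T1 * T2 -> \bar R.

(** By Fubini almost every slice is integrable, so the slices about which nothing is known form a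
    null set and do not affect the outer integral. *)
Lemma integral_null_slices1 : (m1 \x m2).-integrable setT f ->
  (forall x, m2.-integrable setT (fun y => f (x, y)) ->
     \int[m2]_y f (x, y) = 0) ->
  \int[m1 \x m2]_z f z = 0.
Proof.
move=> fi H; rewrite -integral12_prod_meas1//.
rewrite -[RHS](integral0 m1 setT); apply: ae_eq_integral => //.
- exact: measurable_fubini_F fi.
- by have := ae_integrable1 fi; apply: filterS => x /H Hx _.
Qed.

Lemma integral_null_slices2 : (m1 \x m2).-integrable setT f ->
  (forall y, m1.-integrable setT (fun x => f (x, y)) ->
     \int[m1]_x f (x, y) = 0) ->
  \int[m1 \x m2]_z f z = 0.
Proof.
move=> fi H; rewrite -integral21_prod_meas1//.
rewrite -[RHS](integral0 m2 setT); apply: ae_eq_integral => //.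
- exact: measurable_fubini_G fi.
- by have := ae_integrable2 fi; apply: filterS => x /H Hx _.
Qed.

End null_slices.

Lemma line_ex (R : realType) (x y z s : R) :
  ((x, y, z) : vec3 R) + s *: ex = (x + s, y, z).
Proof.
change ((x + s * 1, y + s * 0, z + s * 0) = (x + s, y, z) :> vec3 R).
by rewrite mulr1 !mulr0 !addr0.
Qed.

Lemma line_ey (R : realType) (x y z s : R) :
  ((x, y, z) : vec3 R) + s *: ey = (x, y + s, z).
Proof.
change ((x + s * 0, y + s * 1, z + s * 0) = (x, y + s, z) :> vec3 R).
by rewrite mulr1 !mulr0 !addr0.
Qed.

Lemma line_ez (R : realType) (x y z s : R) :
  ((x, y, z) : vec3 R) + s *: ez = (x, y, z + s).
Proof.
change ((x + s * 0, y + s * 0, z + s * 1) = (x, y, z + s) :> vec3 R).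
by rewrite mulr1 !mulr0 !addr0.
Qed.

Definition axis (R : realType) (e : vec3 R) := [\/ e = ex, e = ey | e = ez].

(** R^3 is nested as (R x R) x R, so lines along [ez] are reached by one use of Fubini and the
    others by two. Each line is represented by its point whose coordinate along [e] is zero. *)
Lemma integral_null_lines (R : realType) (e : vec3 R) (f : vec3 R -> \bar R) :
  axis e -> leb3.-integrable setT f ->
  (forall p : vec3 R, lebesgue_measure.-integrable setT (fun s : R => f (p + s *: e)%R) ->
     (\int[lebesgue_measure]_s f (p + s *: e)%R) = 0)%E ->
  (\int[leb3]_p f p = 0)%E.
Proof.
move=> ax fi H.
case: ax H => -> H.
- apply: integral_null_slices2 => // z fz.
  apply: integral_null_slices2 => // y fy.
  have := H (0, y, z); rewrite (_ : (fun s => _) = fun s => f (s, y, z)) => [|].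
    exact.
  by apply/funext => s; rewrite line_ex add0r.
- apply: integral_null_slices2 => // z fz.
  apply: integral_null_slices1 => // x fx.
  have := H (x, 0, z); rewrite (_ : (fun s => _) = fun s => f (x, s, z)) => [|].
    exact.
  by apply/funext => s; rewrite line_ey add0r.
- apply: integral_null_slices1 => // -[x y] fz.
  have := H (x, y, 0); rewrite (_ : (fun s => _) = fun s => f (x, y, s)) => [|].
    exact.
  by apply/funext => s; rewrite line_ez add0r.
Qed.

(** * Bounded measurable densities *)

Section bounded_measurable.
Context d (T : measurableType d) (R : realType).
Implicit Types (D : set T) (f g : T -> R).

(** The class of weights by which a merely integrable derivative can be multiplied without losing
    integrability. It is stable under sums and products and integrable on sets of finite measure. *)
Definition bmeas D f :=
  measurable_fun D f /\ exists M, forall p, D p -> `|f p| <= M.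

Lemma bmeas_cst D (r : R) : bmeas D (fun=> r).
Proof. by split; [exact: measurable_cst | exists `|r|]. Qed.

Lemma bmeasD D f g : bmeas D f -> bmeas D g -> bmeas D (fun p => f p + g p).
Proof.
move=> [mf [M fM]] [mg [N gN]]; split; first exact: measurable_funD.
exists (M + N) => p Dp; apply: le_trans (ler_normD _ _) _.
by apply: lerD; [exact: fM|exact: gN].
Qed.

Lemma bmeasM D f g : bmeas D f -> bmeas D g -> bmeas D (fun p => f p * g p).
Proof.
move=> [mf [M fM]] [mg [N gN]]; split; first exact: measurable_funM.
exists (M * N) => p Dp; rewrite normrM.
by apply: ler_pM => //; [exact: fM|exact: gN].
Qed.

Lemma bmeas_bounded D f : bmeas D f -> [bounded f x | x in D].
Proof.
move=> [_ [M fM]]; exists M; split; first exact: num_real.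
by move=> N MN p Dp /=; apply: le_trans (fM p Dp) (ltW MN).
Qed.

Lemma bmeas_integrable (mu : {measure set T -> \bar R}) D f :
  measurable D -> (mu D < +oo)%E -> bmeas D f -> mu.-integrable D (EFin \o f).
Proof.
move=> mD Doo bf; apply: measurable_bounded_integrable => //.
  by case: bf.
exact: bmeas_bounded.
Qed.

(** Integrability is kept beside the vanishing because additivity of the integral relies on it; the
    pair is stable under linear combinations. *)
Definition null_int (mu : {measure set T -> \bar R}) D f :=
  mu.-integrable D (EFin \o f) /\ (\int[mu]_(x in D) (f x)%:E = 0)%E.

Lemma null_intD (mu : {measure set T -> \bar R}) D f g : measurable D ->
  null_int mu D f -> null_int mu D g -> null_int mu D (fun p => f p + g p).
Proof.
move=> mD [fi f0] [gi g0]; split; first exact: (integrableD mD fi gi).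
by rewrite integralD_EFin// f0 g0 adde0.
Qed.

Lemma null_intZ (mu : {measure set T -> \bar R}) D f (r : R) : measurable D ->
  null_int mu D f -> null_int mu D (fun p => r * f p).
Proof.
move=> mD [fi f0]; split; first exact: (integrableZl mD r fi).
under eq_integral do rewrite EFinM.
by rewrite integralZl// f0 mule0.
Qed.

Lemma eq_null_int (mu : {measure set T -> \bar R}) D f g : measurable D ->
  (forall p, D p -> f p = g p) -> null_int mu D f -> null_int mu D g.
Proof.
move=> mD fg [fi f0]; split.
  by apply: eq_integrable fi => // x /set_mem Dx /=; rewrite fg.
by rewrite -f0; apply: eq_integral => x /set_mem Dx; rewrite fg.
Qed.

End bounded_measurable.

Section patch_product.
Context (R : realType) (T1 T2 : Type) (A : set T1) (B : set T2).
Implicit Type h : T1 * T2 -> R.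

(** Serves to carry Fubini from whole product spaces over to rectangles, through extension by
    zero. *)
Lemma patch_prod1 h x : (fun y => ((EFin \o h) \_ (A `*` B)) (x, y)) =
  if x \in A then (EFin \o (fun y => h (x, y))) \_ B else cst 0%E.
Proof.
apply/funext => y; rewrite patchE; case: ifPn.
  by rewrite inE => -[/= Ax By]; rewrite mem_set// patchE mem_set.
move=> nAB; case: ifPn => // /set_mem Ax; rewrite patchE; case: ifPn => //.
by move=> /set_mem By; move: nAB; rewrite mem_set.
Qed.

Lemma patch_prod2 h y : (fun x => ((EFin \o h) \_ (A `*` B)) (x, y)) =
  if y \in B then (EFin \o (fun x => h (x, y))) \_ A else cst 0%E.
Proof.
apply/funext => x; rewrite patchE; case: ifPn.
  by rewrite inE => -[/= Ax By]; rewrite mem_set// patchE mem_set.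
move=> nAB; case: ifPn => // /set_mem By; rewrite patchE; case: ifPn => //.
by move=> /set_mem Ax; move: nAB; rewrite mem_set.
Qed.

End patch_product.

Section fubini_bounded.
Context d1 d2 (T1 : measurableType d1) (T2 : measurableType d2) (R : realType).
Variables (m1 : {sigma_finite_measure set T1 -> \bar R})
  (m2 : {sigma_finite_measure set T2 -> \bar R}).
Variables (A : set T1) (B : set T2).
Hypotheses (mA : measurable A) (mB : measurable B).
Hypotheses (Aoo : (m1 A < +oo)%E) (Boo : (m2 B < +oo)%E).
Implicit Type h : T1 * T2 -> R.

Lemma product_measure_fin : ((m1 \x m2) (A `*` B) < +oo)%E.
Proof. by rewrite product_measure1E// lte_mul_pinfty// ge0_fin_numE. Qed.

Lemma bmeas_slice h x : bmeas (A `*` B) h -> A x -> bmeas B (fun y => h (x, y)).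
Proof.
move=> [mh [M hM]] Ax; split; last by exists M => y By; exact: hM.
move=> _ Y mY.
have := mh (measurableX mA mB) Y mY => /(measurable_xsection x).
congr measurable; apply/seteqP; split => y; rewrite /xsection/= inE/=.
  by move=> [[]].
by move=> [].
Qed.

(** Fubini for the extension of [h] by zero. Slices of [h] are bounded and [B] has finite measure,
    so each inner integral is finite and passing from extended to real values loses nothing. *)
Lemma fubini_bmeas h : bmeas (A `*` B) h ->
  m1.-integrable A (EFin \o (fun x => \int[m2]_(y in B) h (x, y))) /\
  (\int[(m1 \x m2)%E]_(z in A `*` B) h z =
   \int[m1]_(x in A) \int[m2]_(y in B) h (x, y)).
Proof.
move=> bh.
have hi : (m1 \x m2)%E.-integrable (A `*` B) (EFin \o h).
  apply: bmeas_integrable => //; first exact: measurableX.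
  exact: product_measure_fin.
have hi' : (m1 \x m2)%E.-integrable setT ((EFin \o h) \_ (A `*` B)).
  apply/integrable_restrict => //; first exact: measurableX.
  by rewrite setTI.
have FE x : A x -> fubini_F m2 ((EFin \o h) \_ (A `*` B)) x =
    (\int[m2]_(y in B) h (x, y))%:E.
  move=> Ax; rewrite /fubini_F patch_prod1 mem_set// -integral_mkcond fineK//.
  by apply: integrable_fin_num => //; apply: bmeas_integrable => //; exact: bmeas_slice.
have FE0 x : ~ A x -> fubini_F m2 ((EFin \o h) \_ (A `*` B)) x = 0%E.
  by move=> Ax; rewrite /fubini_F patch_prod1 memNset// integral0.
split.
  apply: (@eq_integrable _ _ _ _ _ mA (fubini_F m2 ((EFin \o h) \_ (A `*` B)))).
    by move=> x /set_mem Ax; rewrite FE.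
  by apply: integrableS (integrable_fubini_F hi').
rewrite {1}/Rintegral integral_mkcond -integral12_prod_meas1//.
rewrite [RHS]/Rintegral [in RHS]integral_mkcond; congr fine.
apply: eq_integral => x _; rewrite patchE; case: ifPn.
  by move=> /set_mem Ax; rewrite FE.
by move=> /negP Ax; rewrite FE0// => H; apply: Ax; exact: mem_set.
Qed.

End fubini_bounded.

Section null_rectangle_slices.
Context d1 d2 (T1 : measurableType d1) (T2 : measurableType d2) (R : realType).
Variables (m1 : {sigma_finite_measure set T1 -> \bar R})
  (m2 : {sigma_finite_measure set T2 -> \bar R}).
Variables (A : set T1) (B : set T2) (h : T1 * T2 -> R).
Hypotheses (mA : measurable A) (mB : measurable B).

Let int_patch : (m1 \x m2)%E.-integrable (A `*` B) (EFin \o h) ->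
  (m1 \x m2)%E.-integrable setT ((EFin \o h) \_ (A `*` B)).
Proof.
move=> hi; apply/integrable_restrict => //; first exact: measurableX.
by rewrite setTI.
Qed.

Lemma null_int_slices1 :
  (m1 \x m2)%E.-integrable (A `*` B) (EFin \o h) ->
  (forall x, A x -> m2.-integrable B (EFin \o (fun y => h (x, y))) ->
     (\int[m2]_(y in B) (h (x, y))%:E = 0)%E) ->
  null_int (m1 \x m2)%E (A `*` B) h.
Proof.
move=> hi H; split => //; rewrite integral_mkcond.
apply: integral_null_slices1; first exact: int_patch.
move=> x; rewrite patch_prod1; case: ifPn => [/set_mem Ax|_ _]; last exact: integral0.
move=> hxi; rewrite -integral_mkcond; apply: H => //.
by move/integrable_restrict : hxi; rewrite setTI; apply.
Qed.

Lemma null_int_slices2 :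
  (m1 \x m2)%E.-integrable (A `*` B) (EFin \o h) ->
  (forall y, B y -> m1.-integrable A (EFin \o (fun x => h (x, y))) ->
     (\int[m1]_(x in A) (h (x, y))%:E = 0)%E) ->
  null_int (m1 \x m2)%E (A `*` B) h.
Proof.
move=> hi H; split => //; rewrite integral_mkcond.
apply: integral_null_slices2; first exact: int_patch.
move=> y; rewrite patch_prod2; case: ifPn => [/set_mem By|_ _]; last exact: integral0.
move=> hxi; rewrite -integral_mkcond; apply: H => //.
by move/integrable_restrict : hxi; rewrite setTI; apply.
Qed.

End null_rectangle_slices.

(** * Directional derivatives *)

(** Both derivatives are limits of the same difference quotient, by [E]. This turns directional
    derivatives into one-variable derivatives along a line. *)
Lemma is_derive_line (R : realType) (V W : normedModType R) (h : V -> W)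
    (p e : V) (s : R) (d : W) :
  is_derive s (1 : R^o) (fun t : R^o => h (p + t *: e)) d <->
  is_derive (p + s *: e) e h d.
Proof.
have E : (fun t : R => t^-1 *: ((fun t : R => h (p + t *: e)) (t *: (1 : R^o) + s)
      - h (p + s *: e))) =
    (fun t : R => t^-1 *: (h (t *: e + (p + s *: e)) - h (p + s *: e))).
  apply/funext => t; congr (_ *: (h _ - _)).
  by rewrite -[t *: (1 : R^o)]/(t * 1) mulr1 scalerDl addrCA.
split=> -[dh de]; apply: DeriveDef.
- by move: dh; rewrite /derivable /= E.
- by rewrite -de /derive /= E.
- by move: dh; rewrite /derivable /= -E.
- by rewrite -de /derive /= -E.
Qed.

Lemma is_derive_dir (R : realType) (V W : normedModType R) (h : V -> W)
    (p e : V) (d : W) :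
  is_derive (0 : R) (1 : R^o) (fun t : R^o => h (p + t *: e)) d ->
  is_derive p e h d.
Proof. by move/is_derive_line; rewrite scale0r addr0. Qed.

Section components.
Context (R : realType).
Implicit Types (p e : vec3 R).

Lemma vx_line p e (t : R) : vx (p + t *: e) = vx p + t * vx e. Proof. by []. Qed.
Lemma vy_line p e (t : R) : vy (p + t *: e) = vy p + t * vy e. Proof. by []. Qed.
Lemma vz_line p e (t : R) : vz (p + t *: e) = vz p + t * vz e. Proof. by []. Qed.

Lemma continuous_vx : continuous (@vx R).
Proof.
move=> p; apply: (@continuous_comp _ _ _ (@fst (R * R)%type R) fst).
exact: cvg_fst. exact: cvg_fst.
Qed.

Lemma continuous_vy : continuous (@vy R).
Proof.
move=> p; apply: (@continuous_comp _ _ _ (@fst (R * R)%type R) snd).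
exact: cvg_fst. exact: cvg_snd.
Qed.

Lemma continuous_vz : continuous (@vz R).
Proof. by move=> p; exact: cvg_snd. Qed.

Lemma is_derive_dot p e : is_derive p e (fun q => dot q q) (2 * dot e p).
Proof.
apply: is_derive_dir.
(* Along the line the squared norm is a quadratic polynomial in [t]. *)
rewrite (_ : (fun t : R^o => _) = fun t : R => dot p p + t * (2 * dot e p) + t ^+ 2 * dot e e).
  apply: is_derive_eq.
  by rewrite /GRing.scale/=; ring.
by apply/funext => t; rewrite /dot !vx_line !vy_line !vz_line; ring.
Qed.

Lemma is_derive_const_line (h : vec3 R -> R) p e :
  (forall s, h (p + s *: e) = h p) -> is_derive p e h 0.
Proof.
move=> H; apply: is_derive_dir.
rewrite (_ : (fun t : R^o => _) = cst (h p)); first exact: is_derive_cst.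
by apply/funext => t; rewrite H.
Qed.

End components.

(** [l] commutes with difference quotients by linearity and with their limit by continuity. With [l]
    a coordinate projection this differentiates the components of a field. *)
Lemma is_derive_comp_linear (R : realType) (V W : normedModType R)
    (l : W -> R^o) (h : V -> W) (p e : V) :
  linear l -> continuous l -> derivable h p e ->
  is_derive p e (l \o h) (l ('D_e h p)).
Proof.
move=> ll cl dh.
have lB u v : l (u - v) = l u - l v.
  by rewrite addrC -scaleN1r ll scaleN1r addrC.
have lZ k u : l (k *: u) = k *: l u.
  by rewrite -[k *: u]addr0 ll -(subrr 0) lB subrr addr0.
have H : (t^-1 *: ((l \o h) (t *: e + p) - (l \o h) p)) @[t --> 0^'] --> l ('D_e h p).
  rewrite [X in X @ _ --> _](_ : _ = l \o (fun t : R => t^-1 *: (h (t *: e + p) - h p))).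
    by apply: (@cvg_comp _ _ _ _ l _ (nbhs ('D_e h p))); [exact: dh|exact: cl].
  by apply/funext => t /=; rewrite lZ lB.
apply: DeriveDef; first by apply/cvg_ex; exists (l ('D_e h p)).
by apply: cvg_lim.
Qed.

Section C1_functions.
Context (R : realType).
Implicit Types (p e : vec3 R) (F : vec3 R -> vec3 R).

Lemma linear_vx : linear (@vx R : vec3 R -> R^o). Proof. by []. Qed.
Lemma linear_vy : linear (@vy R : vec3 R -> R^o). Proof. by []. Qed.
Lemma linear_vz : linear (@vz R : vec3 R -> R^o). Proof. by []. Qed.

Definition C1_fun (h : vec3 R -> R) :=
  continuous h /\ forall e,
    (forall p, is_derive p e h ('D_e h p)) /\ continuous (fun p => 'D_e h p).

Lemma C1_fun_comp (l : vec3 R -> R) F : linear (l : vec3 R -> R^o) -> continuous l ->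
  C1_on [set: vec3 R] F -> C1_fun (l \o F).
Proof.
move=> ll cl [dF cF].
have dlF e p : is_derive p e (l \o F) (l ('D_e F p)).
  apply: is_derive_comp_linear => //.
  by apply: diff_derivable; exact: dF.
split.
  move=> p; apply: continuous_comp; last exact: cl.
  by apply: differentiable_continuous; exact: dF.
move=> e; split=> [p|].
  by apply: DeriveDef => //; exact: ex_derive.
rewrite (_ : (fun p => _) = l \o (fun p => 'D_e F p)).
  by move=> p; apply: continuous_comp; [exact: cF|exact: cl].
by apply/funext => p; rewrite (@derive_val _ _ _ _ _ _ _ (dlF e p)).
Qed.

End C1_functions.

(** * Boxes and integration by parts in three variables *)

Section boxes.
Context (R : realType).
Implicit Types (a b p : vec3 R).

Lemma boxE a b : box a b = `[vx a, vx b] `*` `[vy a, vy b] `*` `[vz a, vz b].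
Proof.
apply/seteqP; split=> -[[x y] z]; rewrite /box /= !in_itv /=.
  by case.
by case=> -[].
Qed.

Lemma compact_box a b : compact (box a b).
Proof.
by rewrite boxE; apply: compact_setX; [apply: compact_setX|]; exact: segment_compact.
Qed.

Lemma measurable_box a b : @measurable _ (mvec3 R) (box a b).
Proof.
by rewrite boxE; apply: measurableX; [apply: measurableX|]; exact: measurable_itv.
Qed.

Lemma leb3_box a b : (leb3 (box a b) < +oo)%E.
Proof.
have fin (r s : R) : (@lebesgue_measure R `[r, s] < +oo)%E.
  by rewrite lebesgue_measure_itv/=; case: ifP => // _; rewrite -EFinB ltry.
have fin2 (r s t u : R) : (@leb2 R (`[r, s] `*` `[t, u]) < +oo)%E.
  apply: (@product_measure_fin _ _ _ _ _ (@lebesgue_measure R)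
    (@lebesgue_measure R)) => //; exact: fin.
rewrite boxE.
apply: (@product_measure_fin _ _ _ _ _ (@leb2 R) (@lebesgue_measure R)) => //.
  by apply: measurableX; exact: measurable_itv.
  exact: fin2.
exact: fin.
Qed.

Lemma bounded_sub_box (U : set (vec3 R)) : bounded_set U ->
  exists a b, U `<=` box a b.
Proof.
move=> [M [_ HM]].
(* The norm is the maximum norm, so its balls are cubes. *)
exists (- (M + 1), - (M + 1), - (M + 1)), (M + 1, M + 1, M + 1) => p Up.
have := HM (M + 1) (ltr_pwDr ltr01 (lexx M)) p Up.
case: p Up => [[x y] z] Up; rewrite /= !prod_normE /= !ge_max => /andP[/andP[px py] pz].
by split; rewrite /vx/vy/vz/= -ler_norml.
Qed.

Lemma bounded_closure_compact (U : set (vec3 R)) :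
  bounded_set U -> compact (closure U).
Proof.
move=> /bounded_sub_box[a [b Uab]].
have cb : compact (box a b) by exact: compact_box.
apply: (subclosed_compact _ cb); first exact: closed_closure.
rewrite [X in _ `<=` X](closure_id _).1; first exact: closureS.
apply: compact_closed => //; exact: norm_hausdorff.
Qed.

Lemma leb3_bounded (U : set (vec3 R)) : open U -> bounded_set U ->
  (leb3 U < +oo)%E.
Proof.
move=> oU /bounded_sub_box[a [b Uab]]; apply: le_lt_trans (leb3_box a b).
by apply: le_measure => //; rewrite inE; [exact: open_measurable3|exact: measurable_box].
Qed.

Lemma compact_bound (T : topologicalType) (K : set T) (h : T -> R) :
  compact K -> {within K, continuous h} -> exists M, forall q, K q -> `|h q| <= M.
Proof.
move=> cK ch.
have /compact_bounded[M [_ HM]] := continuous_compact ch cK.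
exists (M + 1) => p Kp; apply: (HM (M + 1)); first by rewrite ltrDl.
by exists p.
Qed.

Lemma bmeas_box a b (h : vec3 R -> R) : continuous h ->
  @bmeas _ (mvec3 R) R (box a b) h.
Proof.
move=> ch; have ch' : {within box a b, continuous h} by exact: continuous_subspaceT.
split; first by apply: within_continuous_measurable3 => //; exact: measurable_box.
by have [M HM] := compact_bound (@compact_box a b) ch'; exists M.
Qed.

(** Continuity up to the boundary provides the bound, since the product of the box and [closure U]
    is compact. *)
Lemma bmeas6 a b (U : set (vec3 R)) (h : vec3 R * vec3 R -> R) :
  open U -> bounded_set U ->
  {within [set: vec3 R] `*` closure U, continuous h} ->
  @bmeas _ (mvec3 R * mvec3 R)%type R (box a b `*` U) h.
Proof.
move=> oU bU ch; split.
  apply: within_continuous_measurable6.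
    by apply: measurableX; [exact: measurable_box|exact: open_measurable3].
  apply: continuous_subspaceW ch => -[x v] [/= _ Uv]; split => //.
  exact: subset_closure.
have cK : compact (box a b `*` closure U).
  by apply: compact_setX; [exact: compact_box|exact: bounded_closure_compact].
have ch' : {within box a b `*` closure U, continuous h}.
  by apply: continuous_subspaceW ch => -[x v] [].
have [M HM] := compact_bound cK ch'.
by exists M => -[x v] [/= bx Uv]; apply: HM; split => //=; exact: subset_closure.
Qed.

(** Along an axis only one coordinate depends on [s]. The form [dot e] reads off that coordinate,
    and the other two constraints hold for every [s] or for none. *)
Lemma box_line a b e p : axis e ->
  let S := [set s : R | box a b (p + s *: e)] in
  S = set0 \/ S = `[dot e (a - p), dot e (b - p)]%classic.
Proof.
move=> ax S.
have [H|H] := pselect (exists s, S s); last first.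
  by left; apply/seteqP; split => // s Ss; exfalso; apply: H; exists s.
right; case: H => s0.
have SE s : S s <-> [/\ vx a <= vx p + s * vx e <= vx b,
    vy a <= vy p + s * vy e <= vy b & vz a <= vz p + s * vz e <= vz b] by [].
have dE q : dot e (q - p) = vx e * (vx q - vx p) + vy e * (vy q - vy p)
    + vz e * (vz q - vz p) by [].
rewrite !dE => /SE H; apply/seteqP.
suff H' s : S s <-> (s \in `[vx e * (vx a - vx p) + vy e * (vy a - vy p) + vz e * (vz a - vz p),
  vx e * (vx b - vx p) + vy e * (vy b - vy p) + vz e * (vz b - vz p)]).
  by split=> s /H'.
rewrite SE in_itv/=; move: H; clear -ax.
move: (vx a) (vx b) (vx p) (vy a) (vy b) (vy p) (vz a) (vz b) (vz p).
case: ax => ->; rewrite /vx /vy /vz /= => a1 b1 p1 a2 b2 p2 a3 b3 p3 [H1 H2 H3];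
  (split; [by move=> [/andP[? ?] /andP[? ?] /andP[? ?]]; apply/andP; split; lra
  |by move=> /andP[? ?]; split => //; apply/andP; split; lra]).
Qed.

End boxes.

(** * Vanishing integrals of directional derivatives *)

Section null_derivatives.
Context (R : realType).
Implicit Types (a b p e : vec3 R) (h g : vec3 R -> R).

Lemma continuous_line p e : continuous (fun s : R => p + s *: e).
Proof.
move=> s; apply: cvgD; first exact: cvg_cst.
by apply: cvgZr_tmp; exact: cvg_id.
Qed.

Lemma axis_lt a b e : vx a < vx b -> vy a < vy b -> vz a < vz b ->
  axis e -> forall p, dot e (a - p) < dot e (b - p).
Proof.
move=> hx hy hz ax p.
have dE q : dot e (q - p) = vx e * (vx q - vx p) + vy e * (vy q - vy p)
    + vz e * (vz q - vz p) by [].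
rewrite !dE; move: (vx a) (vx b) (vx p) (vy a) (vy b) (vy p) (vz a) (vz b) (vz p) hx hy hz.
by case: ax => ->; rewrite /vx /vy /vz /= => *; lra.
Qed.

Lemma periodic_axis a b e h p : axis e -> Defs.periodic a b h ->
  h (p + dot e (b - p) *: e) = h (p + dot e (a - p) *: e).
Proof.
move=> ax hp.
have dE q : dot e (q - p) = vx e * (vx q - vx p) + vy e * (vy q - vy p)
    + vz e * (vz q - vz p) by [].
have [H1 H2 H3] := hp (p + dot e (a - p) *: e).
rewrite !dE in H1 H2 H3 *.
have E (r s : R) : p + r *: e + s *: e = p + (r + s) *: e by rewrite scalerDl addrA.
move: (vx a) (vx b) (vx p) (vy a) (vy b) (vy p) (vz a) (vz b) (vz p) H1 H2 H3.
case: ax E => -> E a1 b1 p1 a2 b2 p2 a3 b3 p3 H1 H2 H3; [rewrite -H1|rewrite -H2|rewrite -H3];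
  rewrite E; congr (h (p + _ *: _)); rewrite /vx /vy /vz /=; ring.
Qed.

(** The integral of [g] over a line across the box is the difference of [h] at two points one period
    apart. *)
Lemma null_int_box_derive a b e h g :
  vx a < vx b -> vy a < vy b -> vz a < vz b -> axis e ->
  (forall p, is_derive p e h (g p)) -> continuous g -> Defs.periodic a b h ->
  null_int (@leb3 R) (box a b) g.
Proof.
move=> hx hy hz ax dh cg ph.
have gi : (@leb3 R).-integrable (box a b) (EFin \o g).
  apply: bmeas_integrable; first exact: measurable_box.
    exact: leb3_box.
  exact: bmeas_box.
split => //.
rewrite integral_mkcond; apply: (integral_null_lines ax).
  apply/integrable_restrict => //; first exact: measurable_box.
  by rewrite setTI.
move=> p.
pose S := [set s : R | box a b (p + s *: e)].
have -> : (fun s : R => ((EFin \o g) \_ (box a b)) (p + s *: e)) =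
    (EFin \o (fun s : R => g (p + s *: e))) \_ S.
  apply/funext => s; rewrite !patchE.
  by congr (if _ then _ else _); apply/idP/idP => /set_mem Ss; exact: mem_set.
move=> gpi; rewrite -integral_mkcond.
have := box_line a b p ax; rewrite -/S => -[-> |SE]; first by rewrite integral_set0.
rewrite SE in gpi *.
have lt := axis_lt hx hy hz ax p.
have igp : lebesgue_measure.-integrable `[dot e (a - p), dot e (b - p)]
    (EFin \o (fun s : R => g (p + s *: e))).
  by move/integrable_restrict : gpi; rewrite setTI; exact.
have dline s : is_derive s (1 : R) (fun t : R => h (p + t *: e)) (g (p + s *: e)).
  exact/is_derive_line.
have cgl : continuous (fun s : R => g (p + s *: e)).
  by move=> s; apply: continuous_comp; [exact: continuous_line|exact: cg].
have -> : (0 = (h (p + dot e (b - p) *: e) - h (p + dot e (a - p) *: e))%:E :> \bar R)%E.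
  by rewrite (periodic_axis p ax ph) subrr.
rewrite -(@Rintegral_derive_itv _ (fun s => h (p + s *: e)) (fun s => g (p + s *: e)) _ _ lt)//.
- by rewrite fineK//; exact: integrable_fin_num.
- apply: derivable_within_continuous => s _.
  exact: ex_derive.
- by move=> s _; exact: cgl.
Qed.

(** Every line parallel to [e] on which [g] is integrable falls under [integral_derive_open],
    applied to the trace of [U] on that line. *)
Lemma null_int_open_derive (U : set (vec3 R)) e h g :
  open U -> bounded_set U -> axis e ->
  {within closure U, continuous h} -> (forall p, bdry U p -> h p = 0) ->
  (forall p, U p -> is_derive p e h (g p)) ->
  (forall p, U p -> {for p, continuous g}) ->
  (@leb3 R).-integrable U (EFin \o g) ->
  (\int[leb3]_(p in U) (g p)%:E = 0)%E.
Proof.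
move=> oU bU ax ch h0 dh cg gi.
rewrite integral_mkcond; apply: (integral_null_lines ax).
  apply/integrable_restrict => //; first exact: open_measurable3.
  by rewrite setTI.
move=> p.
pose S := [set s : R | U (p + s *: e)].
have -> : (fun s : R => ((EFin \o g) \_ U) (p + s *: e)) =
    (EFin \o (fun s : R => g (p + s *: e))) \_ S.
  apply/funext => s; rewrite !patchE.
  by congr (if _ then _ else _); apply/idP/idP => /set_mem Ss; exact: mem_set.
move=> gpi; rewrite -integral_mkcond.
have oS : open S.
  apply: (@open_comp _ _ (fun s : R => p + s *: e)) => // s _.
  exact: continuous_line.
(* The trace of [closure U] may be larger than [closure S], but this inclusion suffices: it sends
   boundary points of [S] to [bdry U], where [h] vanishes, and transfers the continuity of [h] to
   the line. *)
have clS s : closure S s -> closure U (p + s *: e).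
  move=> Ss B HB; have [t [St Bt]] := Ss _ (continuous_line (p := p) (e := e) HB).
  by exists (p + t *: e).
apply: (@integral_derive_open _ _ (fun s => h (p + s *: e))) => //.
- have [a [b Uab]] := bounded_sub_box bU.
  have [S0|SE] := box_line a b p ax.
    have -> : S = set0.
      apply/seteqP; split => // s /Uab.
      by rewrite -[box _ _ _]/([set s | box a b (p + s *: e)] s) S0.
    by exists 0; split => // M _ s [].
  have bI : bounded_set (`[dot e (a - p), dot e (b - p)]%classic : set R).
    by apply: compact_bounded; exact: segment_compact.
  have [M [Mr HM]] := bI; exists M; split => // N MN s Ss; apply: (HM N MN).
  by rewrite -SE; exact: Uab.
- apply/subspace_continuousP => s Ss.
  move/subspace_continuousP : ch => /(_ _ (clS _ Ss)) hc.
  apply: cvg_comp hc.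
  move=> B HB.
  have HB' : nbhs s [set t | closure U (p + t *: e) -> B (p + t *: e)].
    exact: (continuous_line (p := p) (e := e) HB).
  by apply: filterS HB' => t Bt /clS; exact: Bt.
- by move=> s Ss nSs; apply: h0; split; [exact: clS|rewrite ((interior_id U).1 oU)].
- by move=> s Ss; apply/is_derive_line; exact: dh.
- move=> s Ss; apply: (@continuous_comp _ _ _ (fun s : R => p + s *: e) g).
    exact: continuous_line.
  exact: cg.
- move/integrable_restrict : gpi; rewrite setTI; apply.
    exact: open_measurable.
  exact: measurableT.
Qed.

End null_derivatives.

(** * Partial derivatives in phase space *)

Section partial.
Context (R : realType) (V1 V2 W : normedModType R).
Implicit Types (f : V1 * V2 -> W) (d : W).

(** Regularity of a density is stated on the product space, whereas the schemes take gradients in x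
    and in v separately. The two difference quotients coincide. *)
Lemma is_derive_fst f (x e : V1) (v : V2) d :
  is_derive (x, v) (e, 0) f d <-> is_derive x e (fun y => f (y, v)) d.
Proof.
have E (t : R) : t *: ((e, 0) : V1 * V2) + (x, v) = (t *: e + x, v).
  by rewrite -[LHS]/(t *: e + x, t *: 0 + v) scaler0 add0r.
have Eq : (fun t : R => t^-1 *: (f (t *: ((e, 0) : V1 * V2) + (x, v)) - f (x, v))) =
  (fun t : R => t^-1 *: (f (t *: e + x, v) - f (x, v))).
  by apply/funext => t; rewrite E.
split=> -[dh de]; apply: DeriveDef.
- by move: dh; rewrite /derivable /= Eq.
- by rewrite -de /derive /= Eq.
- by move: dh; rewrite /derivable /= -Eq.
- by rewrite -de /derive /= -Eq.
Qed.

Lemma is_derive_snd f (x : V1) (v e : V2) d :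
  is_derive (x, v) (0, e) f d <-> is_derive v e (fun w => f (x, w)) d.
Proof.
have E (t : R) : t *: ((0, e) : V1 * V2) + (x, v) = (x, t *: e + v).
  by rewrite -[LHS]/(t *: 0 + x, t *: e + v) scaler0 add0r.
have Eq : (fun t : R => t^-1 *: (f (t *: ((0, e) : V1 * V2) + (x, v)) - f (x, v))) =
  (fun t : R => t^-1 *: (f (x, t *: e + v) - f (x, v))).
  by apply/funext => t; rewrite E.
split=> -[dh de]; apply: DeriveDef.
- by move: dh; rewrite /derivable /= Eq.
- by rewrite -de /derive /= Eq.
- by move: dh; rewrite /derivable /= -Eq.
- by rewrite -de /derive /= -Eq.
Qed.

End partial.

Lemma continuous_pairl (T1 T2 : topologicalType) (y : T2) :
  continuous (fun x : T1 => (x, y)).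
Proof.
move=> x B [[/= U W] [Ux Wy] UW]; apply: filterS Ux => z Uz.
by apply: UW; split => //=; exact: nbhs_singleton.
Qed.

Lemma continuous_pairr (T1 T2 : topologicalType) (x : T1) :
  continuous (fun y : T2 => (x, y)).
Proof.
move=> y B [[/= U W] [Ux Wy] UW]; apply: filterS Wy => z Wz.
by apply: UW; split => //=; exact: nbhs_singleton.
Qed.

(** * Energy balance of one step *)

Section states.
Context (R : realType) (a b : vec3 R) (Ov : set (vec3 R)).
Hypotheses (hx : vx a < vx b) (hy : vy a < vy b) (hz : vz a < vz b).
Hypotheses (oO : open Ov) (bO : bounded_set Ov).
Implicit Types (s : state a b Ov) (e : vec3 R).

Local Notation D := (box a b `*` Ov).
Local Notation mu6 := (@leb3 R \x @leb3 R)%E.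

Definition udens s (q : vec3 R * vec3 R) : R := dens s q.1 q.2.
Local Notation dx s e q := ('D_(e, 0 : vec3 R) (udens s) q).
Local Notation dv s e q := ('D_(0 : vec3 R, e) (udens s) q).

Let mO : @measurable _ (mvec3 R) Ov. Proof. exact: open_measurable3. Qed.
Let mBox : @measurable _ (mvec3 R) (box a b). Proof. exact: measurable_box. Qed.
Let mD : @measurable _ (mvec3 R * mvec3 R)%type D.
Proof. exact: measurableX. Qed.

Lemma is_derive_udens s (q e : vec3 R * vec3 R) : Ov q.2 ->
  is_derive q e (udens s) ('D_e (udens s) q).
Proof.
move=> Oq; have [dC _] := density_C1 (dens_smooth s).
apply: DeriveDef => //; apply: diff_derivable.
by apply: dC; split.
Qed.

Lemma bmeas_udens s : @bmeas _ (mvec3 R * mvec3 R)%type R D (udens s).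
Proof. by apply: bmeas6 => //; exact: density_continuous (dens_smooth s). Qed.

Lemma bmeas_continuous (h : vec3 R * vec3 R -> R) : continuous h ->
  @bmeas _ (mvec3 R * mvec3 R)%type R D h.
Proof. by move=> ch; apply: bmeas6 => //; exact: continuous_subspaceT. Qed.

Lemma bmeas_fst (h : vec3 R -> R) : continuous h ->
  @bmeas _ (mvec3 R * mvec3 R)%type R D (fun q => h q.1).
Proof.
move=> ch; apply: bmeas_continuous => q.
by apply: (@continuous_comp _ _ _ fst h); [exact: cvg_fst|exact: ch].
Qed.

Lemma bmeas_snd (h : vec3 R -> R) : continuous h ->
  @bmeas _ (mvec3 R * mvec3 R)%type R D (fun q => h q.2).
Proof.
move=> ch; apply: bmeas_continuous => q.
by apply: (@continuous_comp _ _ _ snd h); [exact: cvg_snd|exact: ch].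
Qed.

Lemma continuous_dotl e : continuous (dot e).
Proof.
move=> p; apply: cvgD; first apply: cvgD.
- by apply: cvgM; [exact: cvg_cst|exact: continuous_vx].
- by apply: cvgM; [exact: cvg_cst|exact: continuous_vy].
- by apply: cvgM; [exact: cvg_cst|exact: continuous_vz].
Qed.

Lemma continuous_dot2 : continuous (fun p : vec3 R => dot p p).
Proof.
move=> p; apply: cvgD; first apply: cvgD.
- by apply: cvgM; exact: continuous_vx.
- by apply: cvgM; exact: continuous_vy.
- by apply: cvgM; exact: continuous_vz.
Qed.

Lemma integrable_bmeasM (h : vec3 R * vec3 R -> R) s
    (e : vec3 R * vec3 R) :
  @bmeas _ (mvec3 R * mvec3 R)%type R D h ->
  mu6.-integrable D (EFin \o (fun q => h q * 'D_e (udens s) q)).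
Proof.
move=> bh; have := integrableMr mD (proj1 bh) (bmeas_bounded bh)
  (density_integrable (dens_smooth s) e).
exact.
Qed.

(** For fixed v the weight |v|^2 (e . v) is constant in x, and the x-derivative of f integrates to
    zero by periodicity. *)
Lemma transport_null s e : axis e ->
  null_int mu6 D (fun q => dot q.2 q.2 * dot e q.2 * dx s e q).
Proof.
move=> ax; apply: null_int_slices2 => //.
  apply: integrable_bmeasM; apply: bmeasM.
    by apply: (@bmeas_snd (fun p => dot p p)); exact: continuous_dot2.
  by apply: bmeas_snd; exact: continuous_dotl.
move=> v Ovv _ /=.
suff : null_int (@leb3 R) (box a b) (fun x => dot v v * dot e v * dx s e (x, v)).
  by case.
apply: null_intZ => //.
apply: (@null_int_box_derive _ _ _ e (fun x => udens s (x, v))) => //.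
- by move=> x; apply/is_derive_fst; exact: is_derive_udens.
- move=> x; have [_ cC] := density_C1 (dens_smooth s).
  apply: (@continuous_comp _ _ _ (fun x : vec3 R => (x, v)) (fun q => dx s e q)).
    exact: continuous_pairl.
  by apply: cC; split.
- by apply: dens_periodic; exact: subset_closure.
Qed.

(** Since [c] is constant along [e], the integrand is the v-derivative along [e] of c |v|^2 f, a
    function that vanishes on the boundary of [Ov]. *)
Lemma force_null s e (c : vec3 R * vec3 R -> R) : axis e ->
  @bmeas _ (mvec3 R * mvec3 R)%type R D c ->
  (forall x, continuous (fun v => c (x, v))) ->
  (forall x v t, c (x, v + t *: e) = c (x, v)) ->
  null_int mu6 D (fun q =>
    c q * (dot q.2 q.2 * dv s e q + 2 * dot e q.2 * udens s q)).
Proof.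
move=> ax bc cc ce.
have b2 : @bmeas _ (mvec3 R * mvec3 R)%type R D (fun q => dot q.2 q.2).
  by apply: (@bmeas_snd (fun p => dot p p)); exact: continuous_dot2.
have be : @bmeas _ (mvec3 R * mvec3 R)%type R D (fun q => dot e q.2).
  by apply: bmeas_snd; exact: continuous_dotl.
apply: null_int_slices1 => //.
  (* The two terms are integrable for different reasons: the first is a bounded weight times an
     integrable derivative, the second is bounded on a set of finite measure. *)
  have i1 : mu6.-integrable D (EFin \o (fun q => (c q * dot q.2 q.2) * dv s e q)).
    by apply: integrable_bmeasM; exact: bmeasM.
  have i2 : mu6.-integrable D (EFin \o (fun q => c q * (2 * dot e q.2 * udens s q))).
    apply: bmeas_integrable => //.
      apply: product_measure_fin => //; first exact: leb3_box.
      exact: leb3_bounded.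
    apply: bmeasM => //; apply: bmeasM; last exact: bmeas_udens.
    by apply: bmeasM => //; exact: bmeas_cst.
  apply: eq_integrable (integrableD mD i1 i2) => // q _ /=.
  by rewrite -EFinD; congr EFin; ring.
move=> x _ gi /=.
apply: (@null_int_open_derive _ _ e (fun v => c (x, v) * (dot v v * udens s (x, v)))) => //.
- move=> v.
  apply: cvgM; first exact: (continuous_subspaceT (cc x)).
  apply: cvgM; first exact: (continuous_subspaceT continuous_dot2).
  move: v; apply/subspace_continuousP => v clv.
  have /subspace_continuousP/(_ (x, v)) := density_continuous (dens_smooth s).
  move=> /(_ (conj I clv)) cd.
  apply: cvg_comp cd => B HB.
  have HB' : nbhs v [set w | ([set: vec3 R] `*` closure Ov) (x, w) -> B (x, w)].
    exact: (continuous_pairr (x := x) (x0 := v) HB).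
  by apply: filterS HB' => w Bw clw; exact: (Bw (conj I clw)).
- by move=> v bv; rewrite /udens dens_bdry// !mulr0.
- move=> v Ovv.
  have d1 : is_derive v e (fun v => c (x, v)) 0 by apply: is_derive_const_line.
  have d2 := is_derive_dot v e.
  have d3 : is_derive v e (fun v => udens s (x, v)) (dv s e (x, v)).
    by apply/is_derive_snd; exact: is_derive_udens.
  have := is_deriveM d1 (is_deriveM d2 d3).
  by rewrite scaler0 addr0 /GRing.scale/= [udens _ _ * _]mulrC.
- move=> v Ovv.
  have c1 : {for v, continuous (fun v => c (x, v))} by exact: cc.
  have c2 : {for v, continuous (fun v : vec3 R => dot v v)} by exact: continuous_dot2.
  have c3 : {for v, continuous (dot e)} by exact: continuous_dotl.
  have cp : {for v, continuous (fun w : vec3 R => (x, w))}.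
    exact: continuous_pairr.
  have c4 : {for v, continuous (fun v => udens s (x, v))}.
    apply: (@continuous_comp _ _ _ (fun w : vec3 R => (x, w)) (udens s)) => //.
    apply: differentiable_continuous.
    by apply: (proj1 (density_C1 (dens_smooth s))); split.
  have c5 : {for v, continuous (fun v => dv s e (x, v))}.
    apply: (@continuous_comp _ _ _ (fun w : vec3 R => (x, w)) (fun q => dv s e q)) => //.
    by apply: (proj2 (density_C1 (dens_smooth s))); split.
  apply: cvgM => //; apply: cvgD; first exact: cvgM.
  by apply: cvgM => //; apply: cvgM => //; exact: cvg_cst.
Qed.

End states.

(** * The Poynting flux of periodic fields *)

Section fields.
Context (R : realType) (a b : vec3 R).
Hypotheses (hx : vx a < vx b) (hy : vy a < vy b) (hz : vz a < vz b).
Implicit Types (h k : vec3 R -> R) (E B : vec3 R -> vec3 R).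

(** Integration by parts without boundary terms: the integrand is the derivative of the periodic
    product h k. *)
Lemma null_int_product_derive h k e : axis e -> C1_fun h -> C1_fun k ->
  Defs.periodic a b h -> Defs.periodic a b k ->
  null_int (@leb3 R) (box a b) (fun p => h p * 'D_e k p + k p * 'D_e h p).
Proof.
move=> ax [ch dh] [ck dk] ph pk.
apply: (@null_int_box_derive _ _ _ e (fun p => h p * k p)) => //.
- by move=> p; have := is_deriveM ((dh e).1 p) ((dk e).1 p).
- move=> p; apply: cvgD; apply: cvgM.
  + exact: ch. + exact: (dk e).2. + exact: ck. + exact: (dh e).2.
- by move=> p; have [h1 h2 h3] := ph p; have [k1 k2 k3] := pk p; rewrite h1 h2 h3 k1 k2 k3.
Qed.

Lemma periodic_comp (W X : Type) (l : W -> X) (F : vec3 R -> W) :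
  Defs.periodic a b F -> Defs.periodic a b (l \o F).
Proof. by move=> pF p /=; have [-> -> ->] := pF p. Qed.

(** The integrand is the divergence of B x E. *)
Lemma poynting_null E B : C1_on [set: vec3 R] E -> C1_on [set: vec3 R] B ->
  Defs.periodic a b E -> Defs.periodic a b B ->
  null_int (@leb3 R) (box a b)
    (fun x => dot (curl B x) (E x) - dot (curl E x) (B x)).
Proof.
move=> cE cB pE pB.
have ax : axis (@ex R) by constructor 1.
have ay : axis (@ey R) by constructor 2.
have az : axis (@ez R) by constructor 3.
have Ex := C1_fun_comp (@linear_vx R) (@continuous_vx R) cE.
have Ey := C1_fun_comp (@linear_vy R) (@continuous_vy R) cE.
have Ez := C1_fun_comp (@linear_vz R) (@continuous_vz R) cE.
have Bx := C1_fun_comp (@linear_vx R) (@continuous_vx R) cB.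
have By := C1_fun_comp (@linear_vy R) (@continuous_vy R) cB.
have Bz := C1_fun_comp (@linear_vz R) (@continuous_vz R) cB.
have pEl (l : vec3 R -> R) := periodic_comp l pE.
have pBl (l : vec3 R -> R) := periodic_comp l pB.
have mb : @measurable _ (mvec3 R) (box a b) by exact: measurable_box.
(* One fact for each of the six products in the components of B x E, differentiated along the axis
   of its component; the factor [-1] marks the subtracted ones. *)
have x1 := null_int_product_derive ax By Ez (pBl _) (pEl _).
have x2 := null_intZ (-1) mb (null_int_product_derive ax Bz Ey (pBl _) (pEl _)).
have y1 := null_int_product_derive ay Bz Ex (pBl _) (pEl _).
have y2 := null_intZ (-1) mb (null_int_product_derive ay Bx Ez (pBl _) (pEl _)).
have z1 := null_int_product_derive az Bx Ey (pBl _) (pEl _).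
have z2 := null_intZ (-1) mb (null_int_product_derive az By Ex (pBl _) (pEl _)).
have := null_intD mb (null_intD mb (null_intD mb x1 x2) (null_intD mb y1 y2)) (null_intD mb z1 z2).
apply: eq_null_int => // p _.
have curlE F w : dot (curl F p) w = ('D_ey (vz \o F) p - 'D_ez (vy \o F) p) * vx w
   + ('D_ez (vx \o F) p - 'D_ex (vz \o F) p) * vy w
   + ('D_ex (vy \o F) p - 'D_ey (vx \o F) p) * vz w by [].
rewrite !curlE.
have compE l F : (l \o F) p = l (F p) :> R by [].
rewrite !compE.
(* With the twelve partial derivatives taken as arbitrary reals, a polynomial identity remains. *)
do 12! [match goal with |- context ['D_?e ?h p] => move: ('D_e h p) => ? end].
move: (vx _) (vy _) (vz _) (vx _) (vy _) (vz _) => *; ring.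
Qed.

End fields.

Lemma null_int_Rintegral d (T : measurableType d) (R : realType)
    (mu : {measure set T -> \bar R}) (D : set T) (f g h : T -> R) (r : R) :
  measurable D -> mu.-integrable D (EFin \o f) -> mu.-integrable D (EFin \o g) ->
  mu.-integrable D (EFin \o h) ->
  null_int mu D (fun p => f p - g p - r * h p) ->
  \int[mu]_(p in D) f p - \int[mu]_(p in D) g p = r * \int[mu]_(p in D) h p.
Proof.
move=> mD fi gi hi [_ n0].
have rhi : mu.-integrable D (EFin \o (fun p => r * h p)) by exact: (integrableZl mD r hi).
have fgi : mu.-integrable D (EFin \o (fun p => f p - g p)) by exact: (integrableB mD fi gi).
have : \int[mu]_(p in D) (f p - g p - r * h p) = 0 by rewrite /Rintegral n0.
by rewrite RintegralB// RintegralB// RintegralZl// => /eqP; rewrite subr_eq0 => /eqP.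
Qed.

(** * Velocity moments, energy densities and the Lorentz force *)

Section energy.
Context (R : realType) (a b : vec3 R) (Ov : set (vec3 R)).
Hypotheses (hx : vx a < vx b) (hy : vy a < vy b) (hz : vz a < vz b).
Hypotheses (oO : open Ov) (bO : bounded_set Ov).
Implicit Types (s : state a b Ov) (e : vec3 R) (E B : vec3 R -> vec3 R).

Local Notation D := (box a b `*` Ov).
Local Notation mu6 := (@leb3 R \x @leb3 R)%E.
Local Notation bm := (@bmeas _ (mvec3 R * mvec3 R)%type R D).
Local Notation dx s e q := ('D_(e, 0 : vec3 R) (udens s) q).
Local Notation dv s e q := ('D_(0 : vec3 R, e) (udens s) q).

Let mO : @measurable _ (mvec3 R) Ov. Proof. exact: open_measurable3. Qed.
Let mBox : @measurable _ (mvec3 R) (box a b). Proof. exact: measurable_box. Qed.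
Let mD : @measurable _ (mvec3 R * mvec3 R)%type D.
Proof. exact: measurableX. Qed.
Let boxoo : (@leb3 R (box a b) < +oo)%E. Proof. exact: leb3_box. Qed.
Let Ooo : (@leb3 R Ov < +oo)%E. Proof. exact: leb3_bounded. Qed.

(** [j] is the velocity moment of [h]. The pair connects phase-space integrals, where the Vlasov
    equation is used, with the integrals over x in which the current enters Maxwell's equations. *)
Definition moment (h : vec3 R * vec3 R -> R) (j : vec3 R -> R) :=
  bm h /\ forall x, box a b x -> \int[leb3]_(v in Ov) h (x, v) = j x.

Lemma moment_slice_integrable h j x : moment h j -> box a b x ->
  (@leb3 R).-integrable Ov (EFin \o (fun v => h (x, v))).
Proof.
move=> [bh _] bx; apply: bmeas_integrable => //.
exact: (@bmeas_slice _ _ _ _ _ _ _ mBox mO).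
Qed.

Lemma momentD h j h' j' : moment h j -> moment h' j' ->
  moment (fun q => h q + h' q) (fun x => j x + j' x).
Proof.
move=> H H'; have [[bh hj] [bh' hj']] := (H, H'); split; first exact: bmeasD.
move=> x bx; rewrite RintegralD//.
- by rewrite hj// hj'.
- exact: moment_slice_integrable H bx.
- exact: moment_slice_integrable H' bx.
Qed.

Lemma momentZ (c : vec3 R -> R) h j : continuous c -> moment h j ->
  moment (fun q => c q.1 * h q) (fun x => c x * j x).
Proof.
move=> cc H; have [bh hj] := H; split.
  by apply: bmeasM => //; exact: bmeas_fst.
move=> x bx; rewrite /= RintegralZl//; first by rewrite hj.
exact: moment_slice_integrable H bx.
Qed.

Lemma moment_integrable h j : moment h j ->
  (@leb3 R).-integrable (box a b) (EFin \o j) /\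
  \int[mu6]_(q in D) h q = \int[leb3]_(x in box a b) j x.
Proof.
move=> [bh hj].
have [i1 i2] := fubini_bmeas mBox mO boxoo Ooo bh.
split.
  by apply: eq_integrable i1 => // x /set_mem bx /=; rewrite hj.
rewrite i2; apply: eq_Rintegral => x /set_mem bx; exact: hj.
Qed.

Lemma bm_integrable h : bm h -> mu6.-integrable D (EFin \o h).
Proof.
move=> bh; apply: bmeas_integrable => //.
exact: product_measure_fin.
Qed.

Definition kinetic s q := udens s q * dot q.2 q.2.

Lemma bm_kinetic s : bm (kinetic s).
Proof.
apply: bmeasM; first exact: bmeas_udens.
by apply: (@bmeas_snd _ _ _ _ oO bO (fun p => dot p p)); exact: continuous_dot2.
Qed.

Lemma moment_kinetic s :
  moment (kinetic s) (fun x => \int[leb3]_(v in Ov) (dens s x v * dot v v)).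
Proof. by split => //; exact: bm_kinetic. Qed.

Lemma bm_snd_udens s (l : vec3 R -> R) : continuous l -> bm (fun q => udens s q * l q.2).
Proof. by move=> cl; apply: bmeasM; [exact: bmeas_udens|exact: bmeas_snd]. Qed.

(** The power density f (E . v), expanded so that the factors depending on x alone can leave the
    v-integral. *)
Definition power E s q :=
  vx (E q.1) * (udens s q * vx q.2) + vy (E q.1) * (udens s q * vy q.2)
  + vz (E q.1) * (udens s q * vz q.2).

Lemma moment_power E s : continuous E ->
  moment (power E s) (fun x => dot (E x) (current s x)).
Proof.
move=> cE.
have cl (l : vec3 R -> R) : continuous l -> continuous (fun x => l (E x)).
  by move=> cl x; apply: (@continuous_comp _ _ _ E l); [exact: cE|exact: cl].
apply: momentD; first apply: momentD.
- apply: (@momentZ (fun x => vx (E x)) (fun q => udens s q * vx q.2) (fun x => vx (current s x))).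
    by apply: cl; exact: continuous_vx.
  by split => //; apply: bm_snd_udens; exact: continuous_vx.
- apply: (@momentZ (fun x => vy (E x)) (fun q => udens s q * vy q.2) (fun x => vy (current s x))).
    by apply: cl; exact: continuous_vy.
  by split => //; apply: bm_snd_udens; exact: continuous_vy.
- apply: (@momentZ (fun x => vz (E x)) (fun q => udens s q * vz q.2) (fun x => vz (current s x))).
    by apply: cl; exact: continuous_vz.
  by split => //; apply: bm_snd_udens; exact: continuous_vz.
Qed.

Definition field_energy s x := dot (elec s x) (elec s x) + dot (magn s x) (magn s x).

Lemma continuous_elec s : continuous (elec s).
Proof. by move=> x; apply: differentiable_continuous; apply: (elec_C1 s).1. Qed.

Lemma continuous_magn s : continuous (magn s).
Proof. by move=> x; apply: differentiable_continuous; apply: (magn_C1 s).1. Qed.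

Lemma field_energy_integrable s : (@leb3 R).-integrable (box a b) (EFin \o field_energy s).
Proof.
apply: bmeas_integrable => //; apply: bmeas_box => x; apply: cvgD.
- apply: (@continuous_comp _ _ _ (elec s) (fun p => dot p p)).
    exact: continuous_elec.
  exact: continuous_dot2.
- apply: (@continuous_comp _ _ _ (magn s) (fun p => dot p p)).
    exact: continuous_magn.
  exact: continuous_dot2.
Qed.

(** Fubini moves the kinetic part to phase space, where it can be compared with the integrated
    Vlasov equation. *)
Lemma total_energyE s : total_energy s =
  2^-1 * (\int[mu6]_(q in D) kinetic s q + \int[leb3]_(x in box a b) field_energy s x).
Proof. by rewrite (moment_integrable (moment_kinetic s)).2. Qed.

(* The component along [e] of ga E + de (v x B), at q = (x, v). *)
Definition lorentz (ga de : R) E B e q : R :=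
  vx e * (ga * vx (E q.1) + de * (vy q.2 * vz (B q.1) - vz q.2 * vy (B q.1)))
  + vy e * (ga * vy (E q.1) + de * (vz q.2 * vx (B q.1) - vx q.2 * vz (B q.1)))
  + vz e * (ga * vz (E q.1) + de * (vx q.2 * vy (B q.1) - vy q.2 * vx (B q.1))).

Lemma continuous_lorentz ga de E B e : continuous E -> continuous B ->
  continuous (lorentz ga de E B e).
Proof.
move=> cE cB.
have cl1 (l : vec3 R -> R) F : continuous l -> continuous F ->
    continuous (fun q : vec3 R * vec3 R => l (F q.1)).
  move=> cl cF q; apply: (@continuous_comp _ _ _ (F \o fst) l); last exact: cl.
  by apply: (@continuous_comp _ _ _ fst F); [exact: cvg_fst|exact: cF].
have cl2 (l : vec3 R -> R) : continuous l -> continuous (fun q : vec3 R * vec3 R => l q.2).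
  by move=> cl q; apply: (@continuous_comp _ _ _ snd l); [exact: cvg_snd|exact: cl].
have cx := @continuous_vx R; have cy := @continuous_vy R; have cz := @continuous_vz R.
have cD (f g : vec3 R * vec3 R -> R) :
    continuous f -> continuous g -> continuous (fun q => f q + g q).
  by move=> cf cg q; apply: cvgD; [exact: cf|exact: cg].
have cM (f g : vec3 R * vec3 R -> R) :
    continuous f -> continuous g -> continuous (fun q => f q * g q).
  by move=> cf cg q; apply: cvgM; [exact: cf|exact: cg].
have cN (f : vec3 R * vec3 R -> R) : continuous f -> continuous (fun q => - f q).
  by move=> cf q; apply: cvgN; exact: cf.
have cC (r : R) : continuous (fun q : vec3 R * vec3 R => r) by move=> q; exact: cvg_cst.
rewrite /lorentz.
have xE := cl1 _ _ cx cE; have yE := cl1 _ _ cy cE; have zE := cl1 _ _ cz cE.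
have xB := cl1 _ _ cx cB; have yB := cl1 _ _ cy cB; have zB := cl1 _ _ cz cB.
have xv := cl2 _ cx; have yv := cl2 _ cy; have zv := cl2 _ cz.
have cpt (k : R) (f g1 g2 g3 g4 : vec3 R * vec3 R -> R) :
    continuous f -> continuous g1 -> continuous g2 ->
    continuous g3 -> continuous g4 ->
    continuous (fun q => k * (ga * f q + de * (g1 q * g2 q - g3 q * g4 q))).
  move=> cf c1 c2 c3 c4; apply: (cM (fun=> k)); first exact: cC.
  apply: (cD _ _); first by apply: (cM (fun=> ga)); first exact: cC.
  apply: (cM (fun=> de)); first exact: cC.
  by apply: (cD _ _); [exact: cM|apply: cN; exact: cM].
exact: (cD _ _ (cD _ _ (cpt _ _ _ _ _ _ xE yv zB zv yB)
  (cpt _ _ _ _ _ _ yE zv xB xv zB)) (cpt _ _ _ _ _ _ zE xv yB yv xB)).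
Qed.

(** Moving v by t e changes the component by de t e . (e x B), which is zero. This makes [lorentz]
    an admissible weight in [force_null]. *)
Lemma lorentz_line ga de E B e x v t :
  lorentz ga de E B e (x, v + t *: e) = lorentz ga de E B e (x, v).
Proof.
have lE w : lorentz ga de E B e (x, w) =
    vx e * (ga * vx (E x) + de * (vy w * vz (B x) - vz w * vy (B x)))
  + vy e * (ga * vy (E x) + de * (vz w * vx (B x) - vx w * vz (B x)))
  + vz e * (ga * vz (E x) + de * (vx w * vy (B x) - vy w * vx (B x))) by [].
by rewrite !lE vx_line vy_line vz_line; ring.
Qed.

Lemma force_null_axis s ga de E B e : axis e -> continuous E -> continuous B ->
  null_int mu6 D (fun q => lorentz ga de E B e q *
    (dot q.2 q.2 * dv s e q + 2 * dot e q.2 * udens s q)).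
Proof.
move=> ax cE cB; have cl := @continuous_lorentz ga de E B e cE cB.
apply: force_null => //.
- exact: bmeas_continuous.
- move=> x v; apply: (@continuous_comp _ _ _ (fun w => (x, w)) (lorentz ga de E B e)).
    exact: continuous_pairr.
  exact: cl.
- by move=> x v t; rewrite lorentz_line.
Qed.

(** This is |v|^2 v . grad_x f. *)
Definition transport s q :=
  dot q.2 q.2 * dot ex q.2 * dx s ex q + dot q.2 q.2 * dot ey q.2 * dx s ey q
  + dot q.2 q.2 * dot ez q.2 * dx s ez q.

(** With F = ga E + de v x B this is the v-divergence of |v|^2 f F, namely |v|^2 F . grad_v f + 2 (F
    . v) f, as F has zero v-divergence. *)
Definition force ga de E B s q :=
  lorentz ga de E B ex q * (dot q.2 q.2 * dv s ex q + 2 * dot ex q.2 * udens s q)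
  + lorentz ga de E B ey q * (dot q.2 q.2 * dv s ey q + 2 * dot ey q.2 * udens s q)
  + lorentz ga de E B ez q * (dot q.2 q.2 * dv s ez q + 2 * dot ez q.2 * udens s q).

Let ax : axis (@ex R). Proof. by constructor 1. Qed.
Let ay : axis (@ey R). Proof. by constructor 2. Qed.
Let az : axis (@ez R). Proof. by constructor 3. Qed.

Lemma null_int_transport s : null_int mu6 D (transport s).
Proof. by apply: null_intD => //; [apply: null_intD => //|]; exact: transport_null. Qed.

Lemma null_int_force ga de E B s : continuous E -> continuous B ->
  null_int mu6 D (force ga de E B s).
Proof.
move=> cE cB; apply: null_intD => //; [apply: null_intD => //|];
  exact: force_null_axis.
Qed.

Lemma C1_avg (F G : vec3 R -> vec3 R) : C1_on [set: vec3 R] F ->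
  C1_on [set: vec3 R] G -> C1_on [set: vec3 R] (fun x => 2^-1 *: (F x + G x)).
Proof.
move=> [dF cF] [dG cG].
have dFG p : differentiable (fun x => F x + G x) p.
  by apply: differentiableD; [exact: dF|exact: dG].
split=> [p _|e p _].
  by apply: differentiableZ.
rewrite (_ : (fun q => _) = fun q => 2^-1 *: ('D_e F q + 'D_e G q)).
  apply: cvgZl_tmp; apply: cvgD; [exact: cF|exact: cG].
apply/funext => q.
have hF : is_derive q e F ('D_e F q) by apply: DeriveDef => //; apply: diff_derivable; exact: dF.
have hG : is_derive q e G ('D_e G q) by apply: DeriveDef => //; apply: diff_derivable; exact: dG.
have h := is_deriveZ 2^-1 (is_deriveD hF hG).
exact: derive_val.
Qed.

Lemma periodic_avg (F G : vec3 R -> vec3 R) : Defs.periodic a b F ->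
  Defs.periodic a b G -> Defs.periodic a b (fun x => 2^-1 *: (F x + G x)).
Proof.
by move=> pF pG p; have [f1 f2 f3] := pF p; have [g1 g2 g3] := pG p;
  rewrite f1 f2 f3 g1 g2 g3.
Qed.

Lemma derive_avg_x s s' e x v : Ov v ->
  'D_e (fun y => avg_dens s s' y v) x = 2^-1 * (dx s e (x, v) + dx s' e (x, v)).
Proof.
move=> Ovv.
have h1 : is_derive x e (fun y => udens s (y, v)) (dx s e (x, v)).
  by apply/is_derive_fst; exact: is_derive_udens.
have h2 : is_derive x e (fun y => udens s' (y, v)) (dx s' e (x, v)).
  by apply/is_derive_fst; exact: is_derive_udens.
have h := is_deriveZ 2^-1 (is_deriveD h1 h2).
rewrite (_ : (fun y => _) = 2^-1 *: ((fun y => udens s (y, v)) + (fun y => udens s' (y, v)))).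
  by rewrite derive_val.
by apply/funext => y; rewrite /avg_dens mulrC.
Qed.

Lemma derive_avg_v s s' e x v : Ov v ->
  'D_e (avg_dens s s' x) v = 2^-1 * (dv s e (x, v) + dv s' e (x, v)).
Proof.
move=> Ovv.
have h1 : is_derive v e (fun w => udens s (x, w)) (dv s e (x, v)).
  by apply/is_derive_snd; exact: is_derive_udens.
have h2 : is_derive v e (fun w => udens s' (x, w)) (dv s' e (x, v)).
  by apply/is_derive_snd; exact: is_derive_udens.
have h := is_deriveZ 2^-1 (is_deriveD h1 h2).
rewrite (_ : avg_dens s s' x = 2^-1 *: ((fun w => udens s (x, w)) + (fun w => udens s' (x, w)))).
  by rewrite derive_val.
by apply/funext => w; rewrite /avg_dens mulrC.
Qed.

End energy.

(** * Balance of kinetic and field energy in a midpoint step *)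

Section step.
Context (R : realType) (a b : vec3 R) (Ov : set (vec3 R)).
Hypotheses (hx : vx a < vx b) (hy : vy a < vy b) (hz : vz a < vz b).
Hypotheses (oO : open Ov) (bO : bounded_set Ov).
Implicit Types (s : state a b Ov).

Local Notation D := (box a b `*` Ov).
Local Notation mu6 := (@leb3 R \x @leb3 R)%E.

(* Scheme-4 is [al = ga = de = 1]; Scheme-a, -b and -c keep only the terms in
   [al], [ga] and [de] respectively. *)
Variables (s s' : state a b Ov) (t al ga de : R).
Hypothesis t0 : t != 0.
Hypothesis hB : forall x,
  t^-1 *: (magn s' x - magn s x) = - (de *: curl (avg_elec s s') x).
Hypothesis hE : forall x,
  t^-1 *: (elec s' x - elec s x) =
  de *: curl (avg_magn s s') x - ga *: avg_current s s' x.
Hypothesis hf : forall x v, Ov v ->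
  (dens s' x v - dens s x v) / t
  + al * dot v (grad (fun y => avg_dens s s' y v) x)
  + dot (ga *: avg_elec s s' x + de *: cross v (avg_magn s s' x))
        (grad (avg_dens s s' x) v) = 0.

Let mO : @measurable _ (mvec3 R) Ov. Proof. exact: open_measurable3. Qed.
Let mBox : @measurable _ (mvec3 R) (box a b). Proof. exact: measurable_box. Qed.
Let mD : @measurable _ (mvec3 R * mvec3 R)%type D.
Proof. exact: measurableX. Qed.

Let cE : continuous (avg_elec s s').
Proof.
move=> x; apply: differentiable_continuous.
by apply: (C1_avg (elec_C1 s) (elec_C1 s')).1.
Qed.

Let cB : continuous (avg_magn s s').
Proof.
move=> x; apply: differentiable_continuous.
by apply: (C1_avg (magn_C1 s) (magn_C1 s')).1.
Qed.

Let work q := power (avg_elec s s') s q + power (avg_elec s s') s' q.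

Let moment_work : moment a b Ov work (fun x => dot (avg_elec s s' x) (current s x)
  + dot (avg_elec s s' x) (current s' x)).
Proof. by apply: momentD => //; exact: moment_power. Qed.

(** Up to a constant factor the function is the sum of the transport and force terms of both states,
    by the Vlasov equation multiplied by |v|^2. *)
Let kinetic_balance :
  null_int mu6 D (fun q => kinetic s' q - kinetic s q - t * ga * work q).
Proof.
have n1 := null_intD mD (null_int_transport hx hy hz oO bO s)
                        (null_int_transport hx hy hz oO bO s').
have n2 := null_intD mD (null_int_force oO bO ga de s cE cB)
                        (null_int_force oO bO ga de s' cE cB).
(* The factor combines the step [t] with the 1/2 of the averaged density; it also cancels the 2 in 2
   (F . v) f, leaving [t * ga] before the work. *)
have := null_intZ (- (t / 2)) mD (null_intD mD (null_intZ al mD n1) n2).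
apply: eq_null_int => // -[x v] [/= bx Ovv].
have := hf x Ovv.
rewrite /grad !derive_avg_x// !derive_avg_v//.
have lE e : lorentz ga de (avg_elec s s') (avg_magn s s') e (x, v) =
    vx e * (ga * vx (avg_elec s s' x)
      + de * (vy v * vz (avg_magn s s' x)
        - vz v * vy (avg_magn s s' x)))
  + vy e * (ga * vy (avg_elec s s' x)
      + de * (vz v * vx (avg_magn s s' x)
        - vx v * vz (avg_magn s s' x)))
  + vz e * (ga * vz (avg_elec s s' x)
      + de * (vx v * vy (avg_magn s s' x)
        - vy v * vx (avg_magn s s' x))) by [].
rewrite /transport /force !lE /work /power /kinetic.
have uE s1 : udens s1 (x, v) = dens s1 x v by [].
have f1 : (x, v).1 = x by []. have f2 : (x, v).2 = v by [].
rewrite !uE !f1 !f2.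
do 12! [match goal with |- context ['D_?e ?h ?p] => move: ('D_e h p) => ? end].
move: (dens s x v) (dens s' x v) (avg_elec s s' x) (avg_magn s s' x) => f f' E B.
case: v Ovv lE uE f1 f2 E B => [[v1 v2] v3] _ _ _ _ _ [[e1 e2] e3] [[b1 b2] b3].
rewrite /dot /cross /ex /ey /ez /vx /vy /vz /=.
rewrite -![_ *: _]/(_ * _); set X := al * _; set Y := (X in _ + X = 0) => H.
(* The scheme is solved for the new density, with transport term [X] and force term [Y]. In the
   remaining identity the magnetic work cancels because v . (v x B) = 0. *)
have {H} -> : f' = f - t * (X + Y).
  have -> : X + Y = - ((f' - f) / t).
    by apply/eqP; rewrite -addr_eq0 addrC addrA; apply/eqP.
  by field.
by rewrite /X /Y; field.
Qed.

(** As |E'|^2 - |E|^2 = (E' - E) . (E' + E), and likewise for B, Maxwell's equations express the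
    change by averaged fields. The curl terms form the Poynting integrand, and the current term is
    the work. *)
Let field_balance : null_int (@leb3 R) (box a b)
  (fun x => field_energy s' x - field_energy s x
    - (- (t * ga)) * (dot (avg_elec s s' x) (current s x)
                    + dot (avg_elec s s' x) (current s' x))).
Proof.
have pn : null_int (@leb3 R) (box a b) (fun x =>
    dot (curl (avg_magn s s') x) (avg_elec s s' x)
    - dot (curl (avg_elec s s') x) (avg_magn s s' x)).
  exact: (poynting_null hx hy hz
    (C1_avg (elec_C1 s) (elec_C1 s')) (C1_avg (magn_C1 s) (magn_C1 s'))
    (periodic_avg (elec_periodic s) (elec_periodic s'))
    (periodic_avg (magn_periodic s) (magn_periodic s'))).
(* The 2 comes from E' + E being twice the average, [t * de] from the increment. *)
have := null_intZ (2 * t * de) mBox pn.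
apply: eq_null_int => // x _.
have hB' := hB x; have hE' := hE x.
rewrite /field_energy.
have uB : magn s' x = magn s x + t *: (- (de *: curl (avg_elec s s') x)).
  by rewrite -hB' scalerA divff// scale1r addrCA subrr addr0.
have uE : elec s' x = elec s x +
    t *: (de *: curl (avg_magn s s') x - ga *: avg_current s s' x).
  by rewrite -hE' scalerA divff// scale1r addrCA subrr addr0.
have aE : avg_elec s s' x = 2^-1 *: (elec s x + elec s' x) by [].
have aB : avg_magn s s' x = 2^-1 *: (magn s x + magn s' x) by [].
rewrite aE aB uE uB /avg_current.
(* The new fields have been eliminated; with the curls as arbitrary vectors the claim is
   algebraic. *)
move: (curl (avg_elec s s') x) (curl (avg_magn s s') x) (elec s x) (magn s x).
move: (current s x) (current s' x).
case=> [[j1 j2] j3] [[k1 k2] k3] [[c1 c2] c3] [[d1 d2] d3] [[e1 e2] e3] [[b1 b2] b3].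
rewrite /dot /vx /vy /vz /=.
rewrite -![_ *: _]/(_ * _).
by field.
Qed.

(** The work [t * ga * W] gained by the particles is the amount lost by the fields. *)
Lemma energy_step : total_energy s = total_energy s'.
Proof.
have [ji je] := moment_integrable oO bO moment_work.
have := null_int_Rintegral mD (bm_integrable oO bO (bm_kinetic oO bO s'))
  (bm_integrable oO bO (bm_kinetic oO bO s)) (bm_integrable oO bO moment_work.1) kinetic_balance.
have := null_int_Rintegral mBox (field_energy_integrable s')
  (field_energy_integrable s) ji field_balance.
rewrite !(total_energyE oO bO) je.
move: (\int[leb3]_(x in box a b) (dot _ _ + _)) => W.
move: (Rintegral _ _ _) (Rintegral _ _ _) (Rintegral _ _ _) (Rintegral _ _ _).
rewrite mulNr; move: (t * ga * W) => w *; lra.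
Qed.

End step.

(** * Conservation by the composed schemes *)

Section conservation.
Context (R : realType) (a b : vec3 R) (Ov : set (vec3 R)).
Hypotheses (hx : vx a < vx b) (hy : vy a < vy b) (hz : vz a < vz b).
Hypotheses (oO : open Ov) (bO : bounded_set Ov).
Implicit Types (S : @scheme R a b Ov) (t : R).

Definition conservative S :=
  forall s s', S s s' -> total_energy s = total_energy s'.

Lemma conservative_comp S1 S2 : conservative S1 -> conservative S2 ->
  conservative (scheme_comp S1 S2).
Proof. by move=> c1 c2 s s' [m /c2 -> /c1]. Qed.

Lemma dot0l (w : vec3 R) : dot 0 w = 0.
Proof. by rewrite /dot !mul0r !addr0. Qed.

Lemma conservative_scheme4 t : t != 0 -> conservative (scheme4 t).
Proof.
move=> t0 s s' [hB hE hf].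
apply: (@energy_step _ _ _ _ hx hy hz oO bO s s' t 1 1 1 t0).
- by move=> x; rewrite scale1r.
- by move=> x; rewrite !scale1r.
- by move=> x v Ovv; rewrite !scale1r mul1r; exact: hf.
Qed.

Lemma conservative_scheme_a t : t != 0 -> conservative (scheme_a t).
Proof.
move=> t0 s s' [hf hE hB].
apply: (@energy_step _ _ _ _ hx hy hz oO bO s s' t 1 0 0 t0).
- by move=> x; rewrite hB subrr scaler0 scale0r oppr0.
- by move=> x; rewrite hE subrr scaler0 !scale0r subrr.
- by move=> x v Ovv; rewrite !scale0r addr0 dot0l addr0 mul1r; exact: hf.
Qed.

Lemma conservative_scheme_b t : t != 0 -> conservative (scheme_b t).
Proof.
move=> t0 s s' [hf hE hB].
apply: (@energy_step _ _ _ _ hx hy hz oO bO s s' t 0 1 0 t0).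
- by move=> x; rewrite hB subrr scaler0 scale0r oppr0.
- by move=> x; rewrite hE scale0r scale1r sub0r.
- by move=> x v Ovv; rewrite scale1r scale0r mul0r !addr0; exact: hf.
Qed.

Lemma conservative_scheme_c t : t != 0 -> conservative (scheme_c t).
Proof.
move=> t0 s s' [hB hE hf].
apply: (@energy_step _ _ _ _ hx hy hz oO bO s s' t 0 0 1 t0).
- by move=> x; rewrite scale1r.
- by move=> x; rewrite scale1r scale0r subr0.
- by move=> x v Ovv; rewrite scale1r scale0r mul0r addr0 add0r; exact: hf.
Qed.

Lemma conservative_scheme5 t : t != 0 -> conservative (scheme5 t).
Proof.
move=> t0; have t20 : t / 2 != 0 by rewrite mulf_neq0// invr_eq0 pnatr_eq0.
have ca := conservative_scheme_a t20; have cb := conservative_scheme_b t20.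
have cc := conservative_scheme_c t0.
exact: conservative_comp (conservative_comp
  (conservative_comp (conservative_comp ca cb) cc) cb) ca.
Qed.

End conservation.

(** The bound makes [beta2] negative, so that no substep has length zero. *)
Lemma beta1_gt (R : realType) : 2^-1 < beta1 :> R.
Proof.
have p1 : 0 < 2 `^ (3^-1) :> R by rewrite powR_gt0.
have p2 : 0 < 2 `^ (- 3^-1) :> R by rewrite powR_gt0.
rewrite /beta1; lra.
Qed.

Theorem theorem2p3 (R : realType) (a b : vec3 R) (Ov : set (vec3 R))
    (hx : vx a < vx b) (hy : vy a < vy b) (hz : vz a < vz b)
    (Ov_open : open Ov) (Ov_bounded : bounded_set Ov)
    (Dt : R) (Dt_gt0 : 0 < Dt) (sn sn1 : state a b Ov) :
  scheme4F Dt sn sn1 \/ scheme5F Dt sn sn1 ->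
  total_energy sn = total_energy sn1.
Proof.
have b1 := beta1_gt R.
have b1_gt0 : 0 < beta1 :> R by lra.
have b2_lt0 : beta2 < 0 :> R by rewrite /beta2; lra.
have n1 : beta1 * Dt != 0 by rewrite mulf_neq0 ?(gt_eqF b1_gt0) ?(gt_eqF Dt_gt0).
have n2 : beta2 * Dt != 0 by rewrite mulf_neq0 ?(lt_eqF b2_lt0) ?(gt_eqF Dt_gt0).
(* Both compositions have the same shape. [beta3] unfolds to [beta1], so [n1] covers the first and
   third factors; the middle step is negative, which is allowed since conservation asks only for
   [t != 0]. *)
have cF (S : R -> @scheme R a b Ov) :
    (forall t, t != 0 -> conservative (S t)) ->
    conservative (scheme_comp (scheme_comp (S (beta1 * Dt)) (S (beta2 * Dt)))
                              (S (beta3 * Dt))).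
  by move=> cS; apply: conservative_comp; [apply: conservative_comp|]; exact: cS.
case; apply: cF.
- by move=> t; exact: conservative_scheme4.
- by move=> t; exact: conservative_scheme5.
Qed.
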